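(* For every $f\in\mathcal{U}$, the logarithmic coefficients $\gamma_n$ of $f$ satisfy $$\sum_{n=1}^{\infty}|\gamma_{n}|^{2}\leq \sum_{n=1}^{\infty}\frac{1}{n^{2}}=\frac{\pi^{2}}{6}.$$ Equality holds in this inequality for the Koebe function $k(z)=z(1-e^{i\theta}z)^{-2}$, $\theta\in\mathbb{R}$. Further, there exists a function $f\in\mathcal{U}$ such that $|\gamma_{n}|>1/n$ for some $n\ge 1$.
   Context: Let $\mathbb{D}=\{z\in\mathbb{C}:|z|<1\}$ and let $\mathcal{A}$ be the class of functions $f$ analytic in $\mathbb{D}$ with $f(0)=0$ and $f'(0)=1$. The class $\mathcal{U}$ is $$\mathcal{U}=\left\{f\in\mathcal{A}:\ \left|\left(\frac{z}{f(z)}\right)^2f'(z)-1\right|<1 \text{ for all } z\in\mathbb{D}\right\}.$$ Functions in $\mathcal{U}$ are univalent in $\mathbb{D}$, so $f(z)/z$ (with value $1$ at $0$) is non-vanishing in $\mathbb{D}$. The logarithmic coefficients $\gamma_n$ of $f$ are defined by $\frac12\log\frac{f(z)}{z}=\sum_{n=1}^\infty\gamma_n z^n$, $z\in\mathbb{D}$, where the branch of the logarithm vanishes at $z=0$. *)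

(* Defs.v *)
From Stdlib Require Import Reals.
From Coquelicot Require Import Coquelicot.

Local Open Scope R_scope.
Local Open Scope C_scope.

Definition in_disk (z : C) : Prop := (Cmod z < 1)%R.

(* The type parameters force differentiation over C: the default for maps into
   C could be read as differentiation over R. *)
Definition analytic_in_disk (f : C -> C) : Prop :=
  forall z : C, in_disk z ->
    @ex_derive C_AbsRing C_NormedModule f z.

Definition class_A (f : C -> C) : Prop :=
  analytic_in_disk f /\ f 0 = 0 /\ C_derive f 0 = 1.

(* The quotient z / f z has the removable value 1 at 0, so the expression in
   the modulus is 0 there (f'(0) = 1) and the condition at 0 holds for every f
   in class_A.  Since Coq's division is total, [f z <> 0] is written out: it
   says that the quotient is meaningful, the expression having a pole at any
   other zero of f. *)
Definition class_U (f : C -> C) : Prop :=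
  class_A f /\
  forall z : C, in_disk z -> z <> 0 ->
    f z <> 0 /\
    (Cmod ((z / f z) ^ 2 * C_derive f z - 1) < 1)%R.

Definition Cexp (z : C) : C :=
  (exp (Re z) * cos (Im z), exp (Re z) * sin (Im z))%R.

(* g is the branch on the disk of log (f z / z) that vanishes at 0; at z = 0,
   where f z / z has the value 1, Cexp (g 0) = 1 follows from g 0 = 0. *)
Definition log_branch (f g : C -> C) : Prop :=
  (forall z : C, in_disk z -> @continuous C_UniformSpace C_UniformSpace g z) /\
  g 0 = 0 /\
  (forall z : C, in_disk z -> z <> 0 -> Cexp (g z) = f z / z).

(* Coefficients are indexed from 1: the value of gamma at 0 is irrelevant. *)
Definition log_coeffs (f : C -> C) (gamma : nat -> C) : Prop :=
  exists g : C -> C, log_branch f g /\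
    forall z : C, in_disk z ->
      @is_series C_AbsRing C_NormedModule
        (fun n : nat => gamma (S n) * z ^ (S n)) (1 / 2 * g z).

Definition koebe (theta : R) (z : C) : C :=
  z / (1 - Cexp (Ci * theta) * z) ^ 2.

(* Main.v *)
(* Write [f z / z = exp (2 G)] and [omega = 1 - exp (- G)], where [G] is the power
   series with coefficients [gamma n].  The defining inequality of the class [U]
   and Jack's lemma force [|omega| < 1], hence [G = L (omega)] with
   [L u = - log (1 - u)] and [omega 0 = 0], and Littlewood's subordination
   principle in [H^2] bounds [sum |gamma n|^2] by the sum of the squares of the
   coefficients [1 / n] of [L].  For the Koebe function [omega] is a rotation, so
   equality holds.  The function [z / ((1 + z)^2 (1 - z / 2))] is in [U] because
   [h = z / f z] satisfies [(z / f)^2 f' - 1 = h - z h' - 1 = z^3], and it has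
   [gamma 2 = 9/16].

   Cauchy's formula is obtained by contracting the circle to the point, and only
   for real parts.  Since [G] comes with a power series and all other functions
   are built from power series and [exp], Goursat's theorem is not needed. *)
Require Import Defs.
From Stdlib Require Import Reals Ranalysis5 Lra Lia.
From Coquelicot Require Import Coquelicot.
Local Open Scope R_scope.

(** * Complex derivatives and continuity *)

(** The choice of [omega] amounts to [f z / z = 1 / (1 - omega z)^2], so [f] is compared with the
    Koebe function, and [|omega| < 1] is a subordination to it. All estimates live on circles of
    radius [r < 1], where Jack's lemma gives [|omega| <= M < 1] with [M] depending on [r]. The mean
    square estimate therefore treats finitely many coefficients at a time: after [K] of them are
    split off, the remaining ones are at most [1 / K], so the rest is at most [1 / (K (1 - M))] in
    modulus. First [K] tends to infinity with [r] fixed, then [r] tends to 1. The only orthogonality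
    used is that of a constant to a holomorphic function vanishing at 0, which is a mean value of a
    real part; this is why Cauchy's formula for real parts suffices. Schwarz's lemma enters twice:
    it is the radial half of Jack's lemma, and it carries the bound on circles over to the disk. *)

Lemma is_derive_eps {K : AbsRing} {V : NormedModule K} (f : K -> V) (x : K) (l : V) :
  is_derive f x l <->
  forall eps : posreal, exists delta : posreal, forall y : K,
    abs (minus y x) < delta ->
    norm (minus (minus (f y) (f x)) (scal (minus y x) l))
      <= eps * abs (minus y x).
Proof.
  split.
  - intros [_ H] eps.
    destruct (H x (fun P HP => HP) eps) as [d Hd].
    exists d; intros y Hy; exact (Hd y Hy).
  - intros H; split; [exact (is_linear_scal_l l)|].
    intros x' Hx' eps.
    apply (@is_filter_lim_locally_unique K (AbsRing_NormedModule K)) in Hx'.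
    rewrite <- Hx'.
    destruct (H eps) as [d Hd].
    exists d; intros y Hy; exact (Hd y Hy).
Qed.

Definition cderive (f : C -> C) (z l : C) : Prop :=
  @is_derive C_AbsRing C_NormedModule f z l.

Definition ccont {U : UniformSpace} (f : U -> C) (x : U) : Prop :=
  @continuous U C_UniformSpace f x.

(** The product and chain rules refer to [AbsRing_NormedModule C_AbsRing], whose balls are round,
    whereas those of [C_NormedModule] are squares. The epsilon form sees only the norm, which is the
    same for both. *)
Lemma cderive_AbsRing (f : C -> C) (x l : C) :
  cderive f x l <-> @is_derive C_AbsRing (AbsRing_NormedModule C_AbsRing) f x l.
Proof. unfold cderive; rewrite !is_derive_eps; reflexivity. Qed.

Lemma cderive_eps (f : C -> C) (x l : C) :
  cderive f x l <->
  forall eps : posreal, exists delta : posreal, forall y : C,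
    Cmod (y - x) < delta ->
    Cmod (f y - f x - (y - x) * l) <= eps * Cmod (y - x).
Proof. unfold cderive; rewrite is_derive_eps; reflexivity. Qed.

Lemma cderive_const (c x : C) : cderive (fun _ => c) x 0%C.
Proof. exact (is_derive_const c x). Qed.

Lemma cderive_id (x : C) : cderive (fun z => z) x 1%C.
Proof. apply cderive_AbsRing; exact (is_derive_id x). Qed.

Lemma cderive_plus (f g : C -> C) (x lf lg : C) :
  cderive f x lf -> cderive g x lg ->
  cderive (fun z => f z + g z)%C x (lf + lg)%C.
Proof. intros Hf Hg; exact (is_derive_plus f g x lf lg Hf Hg). Qed.

Lemma cderive_minus (f g : C -> C) (x lf lg : C) :
  cderive f x lf -> cderive g x lg ->
  cderive (fun z => f z - g z)%C x (lf - lg)%C.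
Proof. intros Hf Hg; exact (is_derive_minus f g x lf lg Hf Hg). Qed.

Lemma cderive_mult (f g : C -> C) (x lf lg : C) :
  cderive f x lf -> cderive g x lg ->
  cderive (fun z => f z * g z)%C x (lf * g x + f x * lg)%C.
Proof.
  rewrite !cderive_AbsRing; intros Hf Hg.
  exact (is_derive_mult f g x lf lg Hf Hg Cmult_comm).
Qed.

Lemma cderive_comp (f g : C -> C) (x lf lg : C) :
  cderive f (g x) lf -> cderive g x lg ->
  cderive (fun z => f (g z)) x (lg * lf)%C.
Proof.
  intros Hf Hg; apply cderive_AbsRing in Hg.
  exact (is_derive_comp f g x lf lg Hf Hg).
Qed.

Lemma cderive_eq (f : C -> C) (x l l' : C) :
  cderive f x l -> l = l' -> cderive f x l'.
Proof. intros H <-; exact H. Qed.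

Lemma Cmod_le_Re_Im (z : C) : Cmod z <= Rabs (Re z) + Rabs (Im z).
Proof.
  destruct z as [a b]; unfold Cmod, Re, Im; simpl fst; simpl snd.
  apply Rsqr_incr_0_var; [|generalize (Rabs_pos a) (Rabs_pos b); lra].
  rewrite Rsqr_sqrt by nra.
  assert (E : forall t, t ^ 2 = Rabs t * Rabs t) by
   (intros t; rewrite <- Rabs_mult, Rabs_pos_eq; nra).
  rewrite !E; unfold Rsqr; generalize (Rabs_pos a) (Rabs_pos b); nra.
Qed.

Lemma Re_le_Cmod (z : C) : Rabs (Re z) <= Cmod z.
Proof. eapply Rle_trans; [|apply Rmax_Cmod]; apply Rmax_l. Qed.

Lemma Im_le_Cmod (z : C) : Rabs (Im z) <= Cmod z.
Proof. eapply Rle_trans; [|apply Rmax_Cmod]; apply Rmax_r. Qed.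

Lemma ccont_Re_Im {U : UniformSpace} (f : U -> C) (x : U) :
  ccont f x <->
  continuous (fun u => Re (f u)) x /\ continuous (fun u => Im (f u)) x.
Proof.
  split.
  - intros H; split.
    + exact (continuous_comp f (@fst R R) x H (continuous_fst _ _)).
    + exact (continuous_comp f (@snd R R) x H (continuous_snd _ _)).
  - intros [H1 H2] P [e He].
    assert (B1 := H1 _ (locally_ball _ e)); assert (B2 := H2 _ (locally_ball _ e)).
    unfold filtermap in *.
    eapply filter_imp; [|exact (filter_and _ _ B1 B2)].
    intros u [b1 b2]; apply He; split; assumption.
Qed.

Lemma ccont_Re (f : R -> C) (t : R) :
  ccont (U := R_UniformSpace) f t -> continuous (fun s => Re (f s)) t.
Proof. intros H; exact (proj1 (proj1 (ccont_Re_Im (U := R_UniformSpace) f t) H)). Qed.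

(** Bridge between the square balls of [C_UniformSpace], in which continuity is expressed, and
    [Cmod], in which derivatives are estimated. *)
Lemma ccont_eps (f : C -> C) (x : C) :
  ccont f x <->
  forall eps : posreal, exists delta : posreal, forall y : C,
    Cmod (y - x) < delta -> Cmod (f y - f x) < eps.
Proof.
  split.
  - intros H eps.
    assert (e2 : 0 < eps / 2) by (destruct eps; simpl; lra).
    destruct (H _ (locally_ball _ (mkposreal _ e2))) as [d Hd].
    exists d; intros y Hy.
    destruct (Hd y (C_NormedModule_mixin_compat1 _ _ _ Hy)) as [b1 b2].
    eapply Rle_lt_trans; [apply Cmod_le_Re_Im|].
    change (Rabs (Re (f y) - Re (f x)) < eps / 2) in b1.
    change (Rabs (Im (f y) - Im (f x)) < eps / 2) in b2.
    change (Rabs (Re (f y) - Re (f x)) + Rabs (Im (f y) - Im (f x)) < eps).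
    lra.
  - intros H P [e He].
    destruct (H e) as [d Hd].
    (* A square of half-width [d / sqrt 2] lies in the disk of radius [d]. *)
    assert (d2 : 0 < d / sqrt 2).
    { apply Rdiv_lt_0_compat; [apply cond_pos|apply Rlt_sqrt2_0]. }
    exists (mkposreal _ d2); intros y Hy; apply He.
    apply C_NormedModule_mixin_compat1, Hd.
    apply C_NormedModule_mixin_compat2 in Hy; simpl in Hy.
    replace (pos d) with (sqrt 2 * (d / sqrt 2)); [exact Hy|].
    field; apply Rgt_not_eq, Rlt_sqrt2_0.
Qed.

Lemma cderive_ccont (f : C -> C) (x l : C) : cderive f x l -> ccont f x.
Proof.
  rewrite cderive_eps, ccont_eps; intros H eps.
  destruct (H (mkposreal 1 Rlt_0_1)) as [d Hd]; simpl in Hd.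
  assert (M : 0 < 2 + Cmod l) by (generalize (Cmod_ge_0 l); lra).
  assert (e : 0 < Rmin d (eps / (2 + Cmod l))).
  { apply Rmin_pos; [apply cond_pos|apply Rdiv_lt_0_compat; [apply cond_pos|exact M]]. }
  exists (mkposreal _ e); simpl; intros y Hy.
  assert (y1 := Rlt_le_trans _ _ _ Hy (Rmin_l _ _)).
  assert (y2 := Rlt_le_trans _ _ _ Hy (Rmin_r _ _)).
  specialize (Hd y y1).
  replace (f y - f x)%C with ((f y - f x - (y - x) * l) + (y - x) * l)%C by ring.
  eapply Rle_lt_trans; [apply Cmod_triangle|]; rewrite Cmod_mult.
  apply Rlt_div_r in y2; [|exact M].
  generalize (Cmod_ge_0 (y - x)); nra.
Qed.

Section Continuity.
Context {U : UniformSpace}.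
Implicit Types f g : U -> C.

Lemma ccont_const (c : C) (x : U) : ccont (fun _ => c) x.
Proof. apply continuous_const. Qed.

Lemma ccont_plus f g x : ccont f x -> ccont g x -> ccont (fun u => f u + g u)%C x.
Proof.
  rewrite !ccont_Re_Im; intros [f1 f2] [g1 g2]; split.
  - exact (continuous_plus (V := R_NormedModule) _ _ x f1 g1).
  - exact (continuous_plus (V := R_NormedModule) _ _ x f2 g2).
Qed.

Lemma ccont_opp f x : ccont f x -> ccont (fun u => - f u)%C x.
Proof.
  rewrite !ccont_Re_Im; intros [f1 f2]; split.
  - exact (continuous_opp (V := R_NormedModule) _ x f1).
  - exact (continuous_opp (V := R_NormedModule) _ x f2).
Qed.

Lemma ccont_minus f g x : ccont f x -> ccont g x -> ccont (fun u => f u - g u)%C x.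
Proof. intros Hf Hg; apply ccont_plus; [|apply ccont_opp]; assumption. Qed.

Lemma ccont_mult f g x : ccont f x -> ccont g x -> ccont (fun u => f u * g u)%C x.
Proof.
  rewrite !ccont_Re_Im; intros [f1 f2] [g1 g2].
  assert (M : forall p q : U -> R, continuous p x -> continuous q x ->
    continuous (fun u => p u * q u) x)
   by (intros p q; exact (continuous_mult (K := R_AbsRing) p q x)).
  split.
  - exact (continuous_minus (V := R_NormedModule) _ _ x (M _ _ f1 g1) (M _ _ f2 g2)).
  - exact (continuous_plus (V := R_NormedModule) _ _ x (M _ _ f1 g2) (M _ _ f2 g1)).
Qed.

Lemma ccont_Cmod f x : ccont f x -> continuous (fun u => Cmod (f u)) x.
Proof.
  rewrite ccont_Re_Im; intros [f1 f2].
  assert (M : forall p : U -> R, continuous p x -> continuous (fun u => p u ^ 2) x).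
  { intros p Hp; apply (continuous_ext (fun u => p u * p u)).
    - intros u; simpl; ring.
    - exact (continuous_mult (K := R_AbsRing) p p x Hp Hp). }
  apply (continuous_comp _ sqrt).
  - exact (continuous_plus (V := R_NormedModule) _ _ x (M _ f1) (M _ f2)).
  - apply continuous_sqrt.
Qed.

Lemma ccont_comp (F : C -> C) f x : ccont f x -> ccont F (f x) -> ccont (fun u => F (f u)) x.
Proof. exact (continuous_comp f F x). Qed.

End Continuity.

Lemma cderive_Cinv (z : C) : z <> 0%C -> cderive Cinv z (- / (z * z))%C.
Proof.
  intros Hz; apply cderive_eps; intros eps.
  assert (Mz : 0 < Cmod z) by (apply Cmod_gt_0, Hz).
  set (m := Cmod z) in *.
  (* The error is [(y - z)^2 / (z^2 y)]: the first radius keeps [|y| > m / 2], the second then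
     bounds the error by [eps |y - z|]. *)
  assert (e : 0 < Rmin (m / 2) (eps * (m * m * m) / 2)).
  { apply Rmin_pos; [lra|]. generalize (cond_pos eps); intros.
    assert (0 < m * m) by nra. assert (0 < m * m * m) by nra. nra. }
  exists (mkposreal _ e); simpl; intros y Hy.
  assert (y1 := Rlt_le_trans _ _ _ Hy (Rmin_l _ _)).
  assert (y2 := Rlt_le_trans _ _ _ Hy (Rmin_r _ _)).
  assert (Hm : m <= Cmod (y - z) + Cmod y).
  { unfold m; replace z with (- (y - z) + y)%C at 1 by ring.
    rewrite <- (Cmod_opp (y - z)); apply Cmod_triangle. }
  assert (Yy : m / 2 < Cmod y) by lra.
  assert (Hy0 : y <> 0%C) by (apply Cmod_gt_0; lra).
  replace (/ y - / z - (y - z) * - / (z * z))%C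
    with ((y - z) * ((y - z) * / (z * z * y)))%C by (field; auto).
  rewrite !Cmod_mult, Cmod_inv, !Cmod_mult by (repeat apply Cmult_neq_0; auto).
  fold m; rewrite (Rmult_comm eps); apply Rmult_le_compat_l; [apply Cmod_ge_0|].
  apply Rle_div_l.
  - assert (0 < m * m) by nra; nra.
  - generalize (cond_pos eps); intros.
    assert (0 < eps * (m * m)) by (repeat apply Rmult_lt_0_compat; lra).
    nra.
Qed.

Lemma cderive_unique (f : C -> C) (z l : C) : cderive f z l -> C_derive f z = l.
Proof. apply is_C_derive_unique. Qed.

Lemma cderive_ext_loc (f g : C -> C) (z l : C) (d : posreal) :
  (forall y, Cmod (y - z) < d -> f y = g y) -> cderive f z l -> cderive g z l.
Proof.
  rewrite !cderive_eps; intros E H eps.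
  destruct (H eps) as [d' H'].
  assert (e : 0 < Rmin d d') by (apply Rmin_pos; apply cond_pos).
  exists (mkposreal _ e); simpl; intros y Hy.
  assert (y1 := Rlt_le_trans _ _ _ Hy (Rmin_l _ _)).
  assert (y2 := Rlt_le_trans _ _ _ Hy (Rmin_r _ _)).
  rewrite <- !E; auto.
  replace (z - z)%C with (RtoC 0) by ring; rewrite Cmod_0; apply cond_pos.
Qed.

Lemma cderive_ext (f g : C -> C) (z l : C) :
  (forall y, f y = g y) -> cderive f z l -> cderive g z l.
Proof. intros E; apply (cderive_ext_loc f g z l (mkposreal 1 Rlt_0_1)); auto. Qed.

(** * Curves, the complex exponential, holomorphic functions *)

(** Real and imaginary parts are kept apart because the integrals, maxima and mean value theorems
    below concern real functions. *)
Definition curve_derive (p : R -> C) (t : R) (d : C) : Prop :=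
  is_derive (fun s => Re (p s)) t (Re d) /\ is_derive (fun s => Im (p s)) t (Im d).

Lemma is_derive_R_eps (f : R -> R) (t l : R) :
  is_derive f t l <->
  forall eps : posreal, exists delta : posreal, forall s : R,
    Rabs (s - t) < delta ->
    Rabs (f s - f t - (s - t) * l) <= eps * Rabs (s - t).
Proof. rewrite is_derive_eps; reflexivity. Qed.

Lemma curve_derive_eps (p : R -> C) (t : R) (d : C) :
  curve_derive p t d <->
  forall eps : posreal, exists delta : posreal, forall s : R,
    Rabs (s - t) < delta ->
    Cmod (p s - p t - RtoC (s - t) * d) <= eps * Rabs (s - t).
Proof.
  assert (ER : forall s, Re (p s - p t - RtoC (s - t) * d) = Re (p s) - Re (p t) - (s - t) * Re d).
  { intros s; destruct (p s), (p t), d; simpl; ring. }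
  assert (EI : forall s, Im (p s - p t - RtoC (s - t) * d) = Im (p s) - Im (p t) - (s - t) * Im d).
  { intros s; destruct (p s), (p t), d; simpl; ring. }
  unfold curve_derive; rewrite !is_derive_R_eps; split.
  - intros [H1 H2] eps.
    assert (e2 : 0 < eps / 2) by (destruct eps; simpl; lra).
    destruct (H1 (mkposreal _ e2)) as [d1 Hd1].
    destruct (H2 (mkposreal _ e2)) as [d2 Hd2]; simpl pos in *.
    assert (e : 0 < Rmin d1 d2) by (apply Rmin_pos; apply cond_pos).
    exists (mkposreal _ e); simpl; intros s Hs.
    specialize (Hd1 s (Rlt_le_trans _ _ _ Hs (Rmin_l _ _))).
    specialize (Hd2 s (Rlt_le_trans _ _ _ Hs (Rmin_r _ _))).
    eapply Rle_trans; [apply Cmod_le_Re_Im|]; rewrite ER, EI; lra.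
  - intros H; split; intros eps; destruct (H eps) as [d' Hd];
      exists d'; intros s Hs; specialize (Hd s Hs);
      (eapply Rle_trans; [|exact Hd]).
    + rewrite <- ER; apply Re_le_Cmod.
    + rewrite <- EI; apply Im_le_Cmod.
Qed.

Lemma curve_derive_comp (F : C -> C) (p : R -> C) (t : R) (l d : C) :
  cderive F (p t) l -> curve_derive p t d -> curve_derive (fun s => F (p s)) t (l * d)%C.
Proof.
  rewrite !curve_derive_eps, cderive_eps; intros HF Hp eps.
  assert (P1 : 0 < 1 + Cmod d) by (generalize (Cmod_ge_0 d); lra).
  assert (P2 : 0 < 2 * (1 + Cmod l)) by (generalize (Cmod_ge_0 l); lra).
  assert (e1 : 0 < eps / (2 * (1 + Cmod d))).
  { apply Rdiv_lt_0_compat; [apply cond_pos|lra]. }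
  assert (e2 : 0 < Rmin 1 (eps / (2 * (1 + Cmod l)))).
  { apply Rmin_pos; [lra|]; apply Rdiv_lt_0_compat; [apply cond_pos|lra]. }
  destruct (HF (mkposreal _ e1)) as [d1 Hd1].
  destruct (Hp (mkposreal _ e2)) as [d2 Hd2]; simpl in *.
  assert (e : 0 < Rmin d2 (d1 / (1 + Cmod d))).
  { apply Rmin_pos; [apply cond_pos|]; apply Rdiv_lt_0_compat; [apply cond_pos|lra]. }
  exists (mkposreal _ e); simpl; intros s Hs.
  assert (s1 := Rlt_le_trans _ _ _ Hs (Rmin_l _ _)).
  assert (s2 := Rlt_le_trans _ _ _ Hs (Rmin_r _ _)).
  specialize (Hd2 s s1).
  assert (Hd3 := Rle_trans _ _ _ Hd2 (Rmult_le_compat_r _ _ _ (Rabs_pos _) (Rmin_l _ _))).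
  assert (Hd4 := Rle_trans _ _ _ Hd2 (Rmult_le_compat_r _ _ _ (Rabs_pos _) (Rmin_r _ _))).
  clear Hd2.
  assert (L : Cmod (p s - p t) <= (1 + Cmod d) * Rabs (s - t)).
  { replace (p s - p t)%C with ((p s - p t - RtoC (s - t) * d) + RtoC (s - t) * d)%C by ring.
    eapply Rle_trans; [apply Cmod_triangle|]; rewrite Cmod_mult, Cmod_R; lra. }
  apply Rlt_div_r in s2; [|exact P1].
  assert (L1 : Cmod (p s - p t) < d1) by lra.
  specialize (Hd1 _ L1).
  (* The error of [F] along the increment of [p], plus [l] times the error of [p]; each receives
     [eps / 2]. *)
  replace (F (p s) - F (p t) - RtoC (s - t) * (l * d))%C
    with ((F (p s) - F (p t) - (p s - p t) * l) + l * (p s - p t - RtoC (s - t) * d))%C by ring.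
  eapply Rle_trans; [apply Cmod_triangle|]; rewrite Cmod_mult.
  assert (X1 : eps / (2 * (1 + Cmod d)) * Cmod (p s - p t) <= eps / 2 * Rabs (s - t)).
  { replace (eps / 2 * Rabs (s - t))
      with (eps / (2 * (1 + Cmod d)) * ((1 + Cmod d) * Rabs (s - t))) by (field; lra).
    apply Rmult_le_compat_l; lra. }
  assert (X2 : Cmod l * Cmod (p s - p t - RtoC (s - t) * d) <= eps / 2 * Rabs (s - t)).
  { apply Rle_trans with (Cmod l * (eps / (2 * (1 + Cmod l)) * Rabs (s - t))).
    - apply Rmult_le_compat_l; [apply Cmod_ge_0|exact Hd4].
    - rewrite <- Rmult_assoc; apply Rmult_le_compat_r; [apply Rabs_pos|].
      replace (eps / 2) with ((1 + Cmod l) * (eps / (2 * (1 + Cmod l)))) by (field; lra).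
      apply Rmult_le_compat_r; [|lra].
      apply Rlt_le, Rdiv_lt_0_compat; [apply cond_pos|lra]. }
  lra.
Qed.

Lemma curve_derive_mult (p q : R -> C) (t : R) (d e : C) :
  curve_derive p t d -> curve_derive q t e ->
  curve_derive (fun s => p s * q s)%C t (d * q t + p t * e)%C.
Proof.
  intros [p1 p2] [q1 q2].
  assert (M : forall f g df dg, is_derive f t df -> is_derive g t dg ->
     is_derive (fun s => f s * g s) t (df * g t + f t * dg)).
  { intros f g df dg Hf Hg.
    exact (is_derive_mult (K := R_AbsRing) f g t df dg Hf Hg Rmult_comm). }
  split.
  - generalize (is_derive_minus (V := R_NormedModule) _ _ _ _ _ (M _ _ _ _ p1 q1) (M _ _ _ _ p2 q2)).
    intros H; refine (eq_ind _ (fun z => is_derive _ t z) H _ _).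
    unfold minus, plus, opp; simpl; unfold Re, Im; destruct d, e, (p t), (q t); simpl; ring.
  - generalize (is_derive_plus (V := R_NormedModule) _ _ _ _ _ (M _ _ _ _ p1 q2) (M _ _ _ _ p2 q1)).
    intros H; refine (eq_ind _ (fun z => is_derive _ t z) H _ _).
    unfold minus, plus, opp; simpl; unfold Re, Im; destruct d, e, (p t), (q t); simpl; ring.
Qed.

Lemma curve_derive_const (c : C) (t : R) : curve_derive (fun _ => c) t 0%C.
Proof. split; exact (is_derive_const (V := R_NormedModule) _ t). Qed.

Lemma curve_derive_plus (p q : R -> C) (t : R) (d e : C) :
  curve_derive p t d -> curve_derive q t e ->
  curve_derive (fun s => p s + q s)%C t (d + e)%C.
Proof.
  intros [p1 p2] [q1 q2]; split.
  - exact (is_derive_plus (V := R_NormedModule) _ _ _ _ _ p1 q1).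
  - exact (is_derive_plus (V := R_NormedModule) _ _ _ _ _ p2 q2).
Qed.

Lemma curve_derive_RtoC (t : R) : curve_derive RtoC t 1%C.
Proof.
  split; [exact (is_derive_id t)|exact (is_derive_const (V := R_NormedModule) 0 t)].
Qed.

Lemma curve_derive_eq (p : R -> C) (t : R) (d e : C) :
  curve_derive p t d -> d = e -> curve_derive p t e.
Proof. intros H <-; exact H. Qed.

Definition cis (t : R) : C := (cos t, sin t).

Lemma curve_derive_cis (t : R) : curve_derive cis t (Ci * cis t)%C.
Proof.
  split; simpl.
  - auto_derive; [exact I|ring].
  - auto_derive; [exact I|ring].
Qed.

Lemma Cmod_cis (t : R) : Cmod (cis t) = 1.
Proof.
  unfold Cmod, cis; simpl fst; simpl snd; rewrite <- sqrt_1; f_equal.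
  rewrite <- (sin2_cos2 t); unfold Rsqr; ring.
Qed.

Lemma Cexp_cis (t : R) : Cexp (Ci * t) = cis t.
Proof.
  unfold Cexp; rewrite re_mult, im_mult; simpl.
  replace (0 * t - 1 * 0) with 0 by ring; replace (0 * 0 + 1 * t) with t by ring.
  rewrite exp_0, !Rmult_1_l; reflexivity.
Qed.

Lemma cis_2PI : cis (2 * PI) = cis 0.
Proof. unfold cis; rewrite cos_2PI, sin_2PI, cos_0, sin_0; reflexivity. Qed.

Lemma Cexp_plus (x y : C) : Cexp (x + y) = (Cexp x * Cexp y)%C.
Proof.
  unfold Cexp; rewrite re_plus, im_plus, exp_plus, cos_plus, sin_plus.
  unfold Cmult; simpl; f_equal; ring.
Qed.

Lemma Cexp_0 : Cexp 0 = 1%C.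
Proof. unfold Cexp; simpl; rewrite exp_0, cos_0, sin_0; unfold RtoC; f_equal; ring. Qed.

Lemma Cexp_opp (x : C) : Cexp (- x) = (/ Cexp x)%C.
Proof.
  assert (H : (Cexp x * Cexp (- x) = 1)%C).
  { rewrite <- Cexp_plus, Cplus_opp_r; apply Cexp_0. }
  assert (N : Cexp x <> 0%C) by (intros E; rewrite E, Cmult_0_l in H; apply C1_nz; auto).
  rewrite <- (Cmult_1_l (Cexp (- x))), <- (Cinv_l _ N), <- Cmult_assoc, H; ring.
Qed.

Lemma Cexp_neq_0 (x : C) : Cexp x <> 0%C.
Proof.
  intros E; assert (H : (Cexp x * Cexp (- x) = 1)%C)
    by (rewrite <- Cexp_plus, Cplus_opp_r; apply Cexp_0).
  rewrite E, Cmult_0_l in H; apply C1_nz; auto.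
Qed.

Lemma cderive_Cexp_0 : cderive Cexp 0%C 1%C.
Proof.
  apply cderive_eps; intros eps.
  assert (De : is_derive exp 0 1).
  { generalize (is_derive_exp 0); rewrite exp_0; auto. }
  assert (Dc : is_derive cos 0 0) by (auto_derive; [exact I|rewrite sin_0; ring]).
  assert (Ds : is_derive sin 0 1) by (auto_derive; [exact I|rewrite cos_0; ring]).
  rewrite is_derive_R_eps in De, Dc, Ds.
  (* The four error terms of real and imaginary part are at most 1, 3, 4 and 1 times [e * m], so 12
     leaves room. The cap 1 gives [|x| < 1], hence [exp x < 3]. *)
  set (e := Rmin 1 (eps / 12)).
  assert (e0 : 0 < e) by (apply Rmin_pos; [lra|destruct eps; simpl; lra]).
  assert (e1 : e <= 1) by apply Rmin_l.
  assert (e12 : e <= eps / 12) by apply Rmin_r.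
  destruct (De (mkposreal _ e0)) as [d1 H1].
  destruct (Dc (mkposreal _ e0)) as [d2 H2].
  destruct (Ds (mkposreal _ e0)) as [d3 H3]; simpl in *.
  assert (e4 : 0 < Rmin (Rmin d1 d2) (Rmin d3 e)).
  { repeat apply Rmin_pos; try apply cond_pos; lra. }
  exists (mkposreal _ e4); simpl; intros z Hz.
  replace (z - 0)%C with z in * by ring.
  assert (A := Rlt_le_trans _ _ _ Hz (Rmin_l _ _)).
  assert (A1 := Rlt_le_trans _ _ _ A (Rmin_l _ _)).
  assert (A2 := Rlt_le_trans _ _ _ A (Rmin_r _ _)).
  assert (B := Rlt_le_trans _ _ _ Hz (Rmin_r _ _)).
  assert (A3 := Rlt_le_trans _ _ _ B (Rmin_l _ _)).
  assert (A4 := Rlt_le_trans _ _ _ B (Rmin_r _ _)).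
  clear Hz A B.
  assert (X := Re_le_Cmod z); assert (Y := Im_le_Cmod z).
  rewrite Cexp_0; eapply Rle_trans; [apply Cmod_le_Re_Im|].
  assert (ER : Re (Cexp z - 1 - z * 1) = (exp (Re z) - 1 - Re z * 1)
                + exp (Re z) * (cos (Im z) - 1 - Im z * 0)).
  { destruct z as [x y]; unfold Cexp; simpl; ring. }
  assert (EI : Im (Cexp z - 1 - z * 1) = (exp (Re z) - 1) * sin (Im z)
                + (sin (Im z) - 0 - Im z * 1)).
  { destruct z as [x y]; unfold Cexp; simpl; ring. }
  rewrite ER, EI; clear ER EI.
  set (m := Cmod z) in *; set (x := Re z) in *; set (y := Im z) in *.
  specialize (H1 x); specialize (H2 y); specialize (H3 y).
  rewrite Rminus_0_r in H1, H2, H3.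
  specialize (H1 (Rle_lt_trans _ _ _ X A1)); specialize (H2 (Rle_lt_trans _ _ _ Y A2)).
  specialize (H3 (Rle_lt_trans _ _ _ Y A3)).
  rewrite exp_0 in H1; rewrite cos_0 in H2; rewrite sin_0 in H3.
  assert (m0 : 0 <= m) by apply Cmod_ge_0.
  assert (Ex : 0 < exp x < 3).
  { split; [apply exp_pos|]; eapply Rlt_le_trans; [|apply exp_le_3].
    apply exp_increasing; generalize (Rle_abs x); lra. }
  assert (T1 : Rabs (exp x * (cos y - 1 - y * 0)) <= 3 * (e * m)).
  { rewrite Rabs_mult, (Rabs_pos_eq (exp x)) by lra.
    apply Rmult_le_compat; try lra; [apply Rabs_pos|].
    apply Rle_trans with (1 := H2); apply Rmult_le_compat_l; lra. }
  assert (T2 : Rabs (exp x - 1) <= 2 * e).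
  { replace (exp x - 1) with ((exp x - 1 - x * 1) + x) by ring.
    eapply Rle_trans; [apply Rabs_triang|]; generalize (Rabs_pos x); nra. }
  assert (T3 : Rabs (sin y) <= 2 * m).
  { replace (sin y) with ((sin y - 0 - y * 1) + y) by ring.
    eapply Rle_trans; [apply Rabs_triang|]; generalize (Rabs_pos y); nra. }
  assert (T4 : Rabs ((exp x - 1) * sin y) <= 4 * (e * m)).
  { rewrite Rabs_mult; generalize (Rabs_pos (exp x - 1)) (Rabs_pos (sin y)); nra. }
  assert (T5 := Rmult_le_compat_l _ _ _ (Rlt_le _ _ e0) X).
  assert (T6 := Rmult_le_compat_l _ _ _ (Rlt_le _ _ e0) Y).
  assert (T7 := Rmult_le_compat_r _ _ _ m0 e12).
  assert (P := Rabs_triang (exp x - 1 - x * 1) (exp x * (cos y - 1 - y * 0))).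
  assert (Q := Rabs_triang ((exp x - 1) * sin y) (sin y - 0 - y * 1)).
  assert (0 <= e * m) by (apply Rmult_le_pos; lra).
  lra.
Qed.

Lemma cderive_Cexp (z : C) : cderive Cexp z (Cexp z).
Proof.
  apply (cderive_ext (fun y => Cexp z * Cexp (y - z))%C).
  { intros y; rewrite <- Cexp_plus; f_equal; ring. }
  assert (D : cderive (fun y => y - z)%C z 1%C).
  { eapply cderive_eq; [apply cderive_minus; [apply cderive_id|apply cderive_const]|ring]. }
  eapply cderive_eq.
  - apply cderive_mult; [apply cderive_const|].
    apply (cderive_comp Cexp (fun y => y - z)%C z 1%C 1%C); [|exact D].
    replace (z - z)%C with (RtoC 0) by ring; apply cderive_Cexp_0.
  - cbv beta; ring.
Qed.

(* Continuity of the derivative is part of the notion, since Cauchy's formula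
   is obtained below by differentiating under the integral sign. *)
Definition holo (r : R) (F F' : C -> C) : Prop :=
  forall z : C, Cmod z < r -> cderive F z (F' z) /\ ccont F' z.

Lemma holo_ccont (r : R) (F F' : C -> C) (z : C) : holo r F F' -> Cmod z < r -> ccont F z.
Proof. intros H Hz; exact (cderive_ccont _ _ _ (proj1 (H z Hz))). Qed.

Lemma holo_le (r s : R) (F F' : C -> C) : s <= r -> holo r F F' -> holo s F F'.
Proof. intros Hs H z Hz; apply H; lra. Qed.

Lemma holo_const (r : R) (c : C) : holo r (fun _ => c) (fun _ => 0%C).
Proof. intros z _; split; [apply cderive_const|apply ccont_const]. Qed.

Lemma holo_id (r : R) : holo r (fun z => z) (fun _ => 1%C).
Proof. intros z _; split; [apply cderive_id|apply ccont_const]. Qed.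

Lemma holo_plus (r : R) (F F' G G' : C -> C) : holo r F F' -> holo r G G' ->
  holo r (fun z => F z + G z)%C (fun z => F' z + G' z)%C.
Proof.
  intros HF HG z Hz; destruct (HF z Hz), (HG z Hz); split;
    [apply cderive_plus|apply ccont_plus]; assumption.
Qed.

Lemma holo_mult (r : R) (F F' G G' : C -> C) : holo r F F' -> holo r G G' ->
  holo r (fun z => F z * G z)%C (fun z => F' z * G z + F z * G' z)%C.
Proof.
  intros HF HG z Hz.
  assert (cF := holo_ccont _ _ _ _ HF Hz); assert (cG := holo_ccont _ _ _ _ HG Hz).
  destruct (HF z Hz), (HG z Hz); split; [apply cderive_mult; assumption|].
  apply ccont_plus; apply ccont_mult; assumption.
Qed.

Lemma holo_scal (r : R) (c : C) (F F' : C -> C) : holo r F F' ->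
  holo r (fun z => c * F z)%C (fun z => c * F' z)%C.
Proof.
  intros HF z Hz; destruct (HF z Hz); split.
  - eapply cderive_eq; [apply cderive_mult; [apply cderive_const|eassumption]|cbv beta; ring].
  - apply ccont_mult; [apply ccont_const|assumption].
Qed.

Lemma holo_comp (r s : R) (F F' G G' : C -> C) :
  holo s F F' -> holo r G G' -> (forall z, Cmod z < r -> Cmod (G z) < s) ->
  holo r (fun z => F (G z)) (fun z => G' z * F' (G z))%C.
Proof.
  intros HF HG H z Hz.
  assert (cG := holo_ccont _ _ _ _ HG Hz).
  destruct (HG z Hz), (HF (G z) (H z Hz)); split; [apply cderive_comp; assumption|].
  apply ccont_mult; [assumption|apply ccont_comp; assumption].
Qed.

Lemma holo_Cexp_comp (r : R) (G G' : C -> C) : holo r G G' ->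
  holo r (fun z => Cexp (G z)) (fun z => G' z * Cexp (G z))%C.
Proof.
  intros HG z Hz; assert (cG := holo_ccont _ _ _ _ HG Hz); destruct (HG z Hz); split.
  - apply cderive_comp; [apply cderive_Cexp|assumption].
  - apply ccont_mult; [assumption|apply ccont_comp; [assumption|]].
    exact (cderive_ccont _ _ _ (cderive_Cexp (G z))).
Qed.

Lemma ccont_Cinv (z : C) : z <> 0%C -> ccont Cinv z.
Proof. intros Hz; exact (cderive_ccont _ _ _ (cderive_Cinv z Hz)). Qed.

Lemma holo_Cinv_comp (r : R) (G G' : C -> C) : holo r G G' ->
  (forall z, Cmod z < r -> G z <> 0%C) ->
  holo r (fun z => / G z)%C (fun z => G' z * - / (G z * G z))%C.
Proof.
  intros HG H z Hz; assert (cG := holo_ccont _ _ _ _ HG Hz); destruct (HG z Hz); split.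
  - apply cderive_comp; [apply cderive_Cinv, H, Hz|assumption].
  - apply ccont_mult; [assumption|apply ccont_opp].
    apply ccont_comp with (f := fun z => (G z * G z)%C); [apply ccont_mult; assumption|].
    apply ccont_Cinv; apply Cmult_neq_0; apply H, Hz.
Qed.

(** The mean value theorem along the radius to [z], once for each of the real and imaginary
    parts. *)
Lemma holo_const_of_derive_0 (r : R) (F F' : C -> C) : holo r F F' ->
  (forall z, Cmod z < r -> F' z = 0%C) -> forall z, Cmod z < r -> F z = F 0%C.
Proof.
  intros HF H0 z Hz.
  assert (D : forall t, 0 <= t <= 1 -> curve_derive (fun s => F (RtoC s * z)%C) t 0%C).
  { intros t Ht.
    assert (Ht' : Cmod (RtoC t * z) < r).
    { rewrite Cmod_mult, Cmod_R, Rabs_pos_eq by lra; generalize (Cmod_ge_0 z); nra. }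
    eapply curve_derive_eq.
    - apply (curve_derive_comp F (fun s => RtoC s * z)%C).
      + apply HF, Ht'.
      + apply curve_derive_mult; [apply curve_derive_RtoC|apply curve_derive_const].
    - rewrite H0 by exact Ht'; ring. }
  assert (K : forall g : R -> R, (forall t, 0 <= t <= 1 -> is_derive g t 0) -> g 1 = g 0).
  { intros g Hg.
    destruct (MVT_gen g 0 1 (fun _ => 0)) as [c [_ Hc]].
    - intros t; rewrite Rmin_left, Rmax_right by lra; intros; apply Hg; lra.
    - intros t; rewrite Rmin_left, Rmax_right by lra; intros.
      apply continuity_pt_filterlim, (ex_derive_continuous g); exists 0; apply Hg; lra.
    - lra. }
  assert (R1 := K _ (fun t Ht => proj1 (D t Ht))).
  assert (R2 := K _ (fun t Ht => proj2 (D t Ht))).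
  simpl in R1, R2; rewrite Cmult_1_l, Cmult_0_l in R1, R2.
  destruct (F z), (F 0%C); simpl in *; congruence.
Qed.

(** * Cauchy's formula on circles *)

Definition circle (r t : R) : C := (RtoC r * cis t)%C.

Lemma Cmod_circle (r t : R) : 0 <= r -> Cmod (circle r t) = r.
Proof.
  intros Hr; unfold circle; rewrite Cmod_mult, Cmod_cis, Cmod_R, Rabs_pos_eq by exact Hr; ring.
Qed.

Lemma circle_neq_0 (r t : R) : 0 < r -> circle r t <> 0%C.
Proof. intros Hr; apply Cmod_gt_0; rewrite Cmod_circle; lra. Qed.

Lemma circle_minus_neq_0 (r t : R) (a : C) : Cmod a < r -> (circle r t - a <> 0)%C.
Proof.
  intros Ha E; apply (Rlt_irrefl r).
  rewrite <- (Cmod_circle r t) at 1 by (generalize (Cmod_ge_0 a); lra).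
  replace (circle r t) with (circle r t - a + a)%C by ring.
  rewrite E, Cplus_0_l; exact Ha.
Qed.

Lemma curve_derive_circle (r t : R) : curve_derive (circle r) t (Ci * circle r t)%C.
Proof.
  unfold circle; eapply curve_derive_eq.
  - apply curve_derive_mult; [apply curve_derive_const|apply curve_derive_cis].
  - cbv beta; ring.
Qed.

Lemma ccont_circle {U : UniformSpace} (r : R) (g : U -> R) (x : U) :
  continuous g x -> ccont (fun u => circle r (g u)) x.
Proof.
  intros Hg; apply ccont_mult; [apply ccont_const|].
  apply ccont_Re_Im; split; apply (continuous_comp g); auto;
    [apply continuous_cos|apply continuous_sin].
Qed.

Lemma ccont_RtoC {U : UniformSpace} (g : U -> R) (x : U) :
  continuous g x -> ccont (fun u => RtoC (g u)) x.
Proof.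
  intros Hg; apply ccont_Re_Im; split; [exact Hg|apply continuous_const].
Qed.

Lemma continuous_ex_RInt (f : R -> R) (a b : R) :
  (forall t, continuous f t) -> ex_RInt f a b.
Proof. intros H; apply (ex_RInt_continuous (V := R_CompleteNormedModule)); auto. Qed.

Lemma is_RInt_eq (f g : R -> R) (a b x y : R) :
  (forall t, f t = g t) -> x = y -> is_RInt f a b x -> is_RInt g a b y.
Proof. intros E <-; apply is_RInt_ext; intros t _; apply E. Qed.

(* [s] runs along the homotopy contracting the circle to the point [a]. *)
Lemma Cauchy_Re_diff (R0 r : R) (F F' : C -> C) (a : C) :
  holo R0 F F' -> r < R0 -> Cmod a < r ->
  is_RInt (fun t => Re ((F (circle r t) - F a) * (circle r t / (circle r t - a)))) 0 (2 * PI) 0.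
Proof.
  intros HF Hr Ha.
  assert (r0 : 0 < r) by (generalize (Cmod_ge_0 a); lra).
  set (w := fun s t => (a + RtoC s * (circle r t - a))%C).
  set (u := fun s t => Re ((F (w s t) - F a) * (circle r t / (circle r t - a)))).
  (* This is the [s]-derivative of [u]: the chain rule produces the factor [circle r t - a], which
     cancels the denominator of the kernel. *)
  set (v := fun s t => Re (F' (w s t) * circle r t)).
  (* A margin beyond [[0, 1]] for which [(1 + 2 e) r < R0], so that [u] can be differentiated at
     [s = 0] and [s = 1] as well. *)
  set (e := (R0 - r) / (4 * r)).
  assert (e0 : 0 < e) by (apply Rdiv_lt_0_compat; lra).
  assert (er : e * (4 * r) = R0 - r) by (unfold e; field; lra).
  assert (Hw : forall s t, - e < s < 1 + e -> Cmod (w s t) < R0).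
  { intros s t Hs.
    replace (w s t) with (RtoC (1 - s) * a + RtoC s * circle r t)%C
      by (unfold w; rewrite RtoC_minus; ring).
    eapply Rle_lt_trans; [apply Cmod_triangle|].
    rewrite !Cmod_mult, !Cmod_R, Cmod_circle by lra.
    assert (Rabs (1 - s) + Rabs s <= 1 + 2 * e) by (unfold Rabs; repeat destruct Rcase_abs; lra).
    generalize (Rabs_pos (1 - s)) (Cmod_ge_0 a); nra. }
  assert (Cw : forall s t, ccont (U := prod_UniformSpace R_UniformSpace R_UniformSpace)
      (fun p => w (fst p) (snd p)) (s, t)).
  { intros s t; apply ccont_plus; [apply ccont_const|].
    apply ccont_mult; [apply ccont_RtoC, continuous_fst|].
    apply ccont_minus; [apply ccont_circle, continuous_snd|apply ccont_const]. }
  assert (Cwt : forall s t, ccont (U := R_UniformSpace) (fun t => w s t) t).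
  { intros s t; apply ccont_plus; [apply ccont_const|].
    apply ccont_mult; [apply ccont_const|].
    apply ccont_minus; [apply ccont_circle, continuous_id|apply ccont_const]. }
  assert (Du : forall s t, - e < s < 1 + e -> is_derive (fun s => u s t) s (v s t)).
  { intros s t Hs.
    assert (D : curve_derive (fun s => (F (w s t) - F a) * (circle r t / (circle r t - a)))%C s
              (F' (w s t) * circle r t)%C).
    { eapply curve_derive_eq.
      - apply curve_derive_mult; [|apply curve_derive_const].
        apply (curve_derive_plus (fun s => F (w s t)) (fun _ => (- F a)%C));
          [|apply curve_derive_const].
        apply (curve_derive_comp F (fun s => w s t)); [apply HF, Hw, Hs|].
        apply curve_derive_plus; [apply curve_derive_const|].
        apply curve_derive_mult; [apply curve_derive_RtoC|apply curve_derive_const].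
      - cbv beta; field; apply circle_minus_neq_0, Ha. }
    exact (proj1 D). }
  assert (Cv : forall s t, - e < s < 1 + e -> continuity_2d_pt v s t).
  { intros s t Hs; apply continuity_2d_pt_filterlim.
    apply (ccont_Re_Im (U := prod_UniformSpace R_UniformSpace R_UniformSpace)
             (fun p => (F' (w (fst p) (snd p)) * circle r (snd p))%C) (s, t)).
    apply ccont_mult; [|apply ccont_circle, continuous_snd].
    apply (ccont_comp F' (fun p => w (fst p) (snd p))); [apply Cw|].
    apply HF, Hw, Hs. }
  assert (Hloc : forall s, 0 <= s <= 1 -> forall y, Rabs (y - s) < e -> - e < y < 1 + e).
  { intros s Hs y Hy; apply Rabs_def2 in Hy; lra. }
  assert (Iu : forall y, - e < y < 1 + e -> ex_RInt (u y) 0 (2 * PI)).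
  { intros y Hy; apply continuous_ex_RInt; intros t.
      apply (ccont_Re (fun t => ((F (w y t) - F a) * (circle r t / (circle r t - a)))%C)).
      assert (Cc : ccont (U := R_UniformSpace) (circle r) t) by apply ccont_circle, continuous_id.
      apply ccont_mult; [apply ccont_minus|apply ccont_mult]; try apply ccont_const; auto.
      + apply (ccont_comp F (fun t => w y t)); [apply Cwt|].
        apply (holo_ccont _ _ _ _ HF), Hw, Hy.
      + apply (ccont_comp Cinv (fun t => (circle r t - a)%C)).
        * apply ccont_minus; [exact Cc|apply ccont_const].
        * apply ccont_Cinv, circle_minus_neq_0, Ha. }
  assert (D1 : forall s, 0 <= s <= 1 ->
    is_derive (fun s => RInt (u s) 0 (2 * PI)) s (RInt (v s) 0 (2 * PI))).
  { intros s Hs.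
    replace (RInt (v s) 0 (2 * PI)) with (RInt (fun t => Derive (fun s => u s t) s) 0 (2 * PI)).
    2: { apply RInt_ext; intros t _; apply is_derive_unique, Du; lra. }
    apply (is_derive_RInt_param u).
    - exists (mkposreal _ e0); intros y Hy t _; exists (v y t); apply Du, (Hloc s Hs), Hy.
    - intros t _; apply continuity_2d_pt_ext_loc with v.
      + exists (mkposreal _ e0); intros y t' Hy _; symmetry.
        apply is_derive_unique, Du, (Hloc s Hs), Hy.
      + apply Cv; lra.
    - exists (mkposreal _ e0); intros y Hy; apply Iu, (Hloc s Hs), Hy. }
  (* The [t]-derivative of [F (w s t)] is [Ci * s] times the complex number whose real part is [v];
     so [v] has the periodic primitive [Im (F (w s t)) / s]. The division excludes [s = 0], but the
     mean value theorem in [s] only asks for the open interval. *)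
  assert (Z : forall s, 0 < s < 1 -> RInt (v s) 0 (2 * PI) = 0).
  { intros s Hs; apply is_RInt_unique.
    replace 0 with (minus (Im (F (w s (2 * PI))) / s) (Im (F (w s 0)) / s)) at 2.
    2: { unfold w, circle; rewrite cis_2PI; unfold minus, plus, opp; simpl; ring. }
    apply (is_RInt_derive (fun t => Im (F (w s t)) / s) (v s)).
    - intros t _.
      assert (D : curve_derive (fun t => F (w s t)) t (Ci * (RtoC s * (F' (w s t) * circle r t)))%C).
      { eapply curve_derive_eq.
        - apply (curve_derive_comp F (fun t => w s t)); [apply HF, Hw; lra|].
          apply curve_derive_plus; [apply curve_derive_const|].
          apply curve_derive_mult; [apply curve_derive_const|].
          apply (curve_derive_plus (circle r) (fun _ => (- a)%C));
            [apply curve_derive_circle|apply curve_derive_const].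
        - cbv beta; ring. }
      destruct D as [_ D].
      apply (is_derive_ext (fun t => / s * Im (F (w s t)))).
      { intros y; apply Rmult_comm. }
      replace (v s t) with (/ s * Im (Ci * (RtoC s * (F' (w s t) * circle r t)))).
      + exact (is_derive_scal _ _ _ _ D).
      + unfold v; destruct (F' (w s t) * circle r t)%C; simpl; field; lra.
    - intros t _.
      apply (ccont_Re (fun t => (F' (w s t) * circle r t)%C)), ccont_mult.
      + apply (ccont_comp F' (fun t => w s t)); [apply Cwt|apply HF, Hw; lra].
      + apply ccont_circle, continuous_id. }
  assert (E : RInt (u 1) 0 (2 * PI) = RInt (u 0) 0 (2 * PI)).
  { destruct (MVT_gen (fun s => RInt (u s) 0 (2 * PI)) 0 1 (fun _ => 0)) as [c [_ Hc]].
    - intros s; rewrite Rmin_left, Rmax_right by lra; intros Hs.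
      refine (eq_ind _ (fun z => is_derive _ s z) (D1 s _) _ (Z s Hs)); lra.
    - intros s; rewrite Rmin_left, Rmax_right by lra; intros Hs.
      apply continuity_pt_filterlim, (ex_derive_continuous (fun s => RInt (u s) 0 (2 * PI))).
      eexists; apply D1, Hs.
    - lra. }
  apply (is_RInt_ext (u 1)).
  { intros t _; unfold u, w.
    replace (a + RtoC 1 * (circle r t - a))%C with (circle r t) by ring; reflexivity. }
  replace 0 with (RInt (u 1) 0 (2 * PI)) at 2; [apply (RInt_correct (V := R_CompleteNormedModule)), Iu; lra|].
  rewrite E; transitivity (RInt (fun _ => 0) 0 (2 * PI)).
  { apply RInt_ext; intros t _; unfold u, w.
    replace (a + RtoC 0 * (circle r t - a))%C with a by ring.
    replace (F a - F a)%C with (RtoC 0) by ring; rewrite Cmult_0_l; reflexivity. }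
  rewrite RInt_const; unfold scal; simpl; unfold mult; simpl; ring.
Qed.

Lemma mean_value_Re (R0 r : R) (F F' : C -> C) :
  holo R0 F F' -> 0 < r < R0 ->
  is_RInt (fun t => Re (F (circle r t))) 0 (2 * PI) (2 * PI * Re (F 0%C)).
Proof.
  intros HF Hr.
  assert (H := Cauchy_Re_diff R0 r F F' 0%C HF (proj2 Hr)).
  rewrite Cmod_0 in H; specialize (H (proj1 Hr)).
  assert (P := is_RInt_plus (V := R_NormedModule) _ _ _ _ _ _ H
     (is_RInt_const (V := R_NormedModule) 0 (2 * PI) (Re (F 0%C)))).
  refine (is_RInt_eq _ _ _ _ _ _ _ _ P).
  - intros t.
    assert (N := circle_neq_0 r t (proj1 Hr)).
    replace ((F (circle r t) - F 0) * (circle r t / (circle r t - 0)))%C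
      with (F (circle r t) - F 0)%C.
    + change (Re (F (circle r t)) - Re (F 0%C) + Re (F 0%C) = Re (F (circle r t))); ring.
    + replace (circle r t - 0)%C with (circle r t) by ring; field; exact N.
  - change (0 + (2 * PI - 0) * Re (F 0%C) = 2 * PI * Re (F 0%C)); ring.
Qed.

(** * Schwarz's lemma *)

Lemma circle_conj (r t : R) : (Cconj (circle r t) * circle r t = RtoC (r * r))%C.
Proof.
  rewrite Cmult_comm; unfold circle, cis, Cconj, Cmult, RtoC; simpl; f_equal; [|ring].
  generalize (sin2_cos2 t); unfold Rsqr; intros E.
  transitivity (r * r * (sin t * sin t + cos t * cos t)); [ring|rewrite E; ring].
Qed.

Lemma Re_le_Cmod_weak (z : C) : Re z <= Cmod z.
Proof. eapply Rle_trans; [apply Rle_abs|apply Re_le_Cmod]. Qed.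

Lemma Cconj_neq_0 (z : C) : z <> 0%C -> Cconj z <> 0%C.
Proof. intros H; apply Cmod_gt_0; rewrite Cmod_conj; apply Cmod_gt_0, H. Qed.

(** Conjugation keeps the real part, and [r^2 = Cconj z * z] on the circle turns the conjugate
    kernel into a function of [z] alone, to which the mean value property applies. *)
Lemma Re_Cauchy_kernel (r t : R) (a d : C) : Cmod a < r ->
  Re (d * (circle r t / (circle r t - a)))
    = Re (Cconj d * (RtoC (r * r) * / (RtoC (r * r) - Cconj a * circle r t))).
Proof.
  intros Ha.
  assert (r0 : 0 < r) by (generalize (Cmod_ge_0 a); lra).
  assert (N := circle_minus_neq_0 r t a Ha); assert (N0 := circle_neq_0 r t r0).
  assert (N' := Cconj_neq_0 _ N); rewrite Cminus_conj in N'.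
  rewrite <- (circle_conj r t), <- (re_conj (d * (circle r t / (circle r t - a)))), Cmult_conj, Cdiv_conj, Cminus_conj by exact N.
  assert (N2 : (Cconj (circle r t) * circle r t - Cconj a * circle r t)%C <> 0%C).
  { replace (Cconj (circle r t) * circle r t - Cconj a * circle r t)%C
      with ((Cconj (circle r t) - Cconj a) * circle r t)%C by ring.
    apply Cmult_neq_0; assumption. }
  f_equal; field; auto.
Qed.

(* The function inverted here is the denominator of the Cauchy kernel after
   complex conjugation on the circle, where it becomes analytic in [z]. *)
Lemma holo_conj_kernel (r : R) (a : C) : Cmod a < r ->
  exists R0 Q', r < R0 /\ holo R0 (fun z => / (RtoC (r * r) + - Cconj a * z))%C Q'.
Proof.
  intros Ha; assert (a0 := Cmod_ge_0 a).
  (* The pole has modulus [r^2 / |a|]; the midpoint [m] puts [r^2 / m] strictly between [r] and it,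
     and is positive even for [a = 0]. *)
  set (m := (Cmod a + r) / 2).
  assert (m0 : 0 < m) by (unfold m; lra).
  exists (r * r / m); eexists; split.
  - apply Rlt_div_r; [exact m0|unfold m; nra].
  - apply (holo_Cinv_comp _ (fun z => RtoC (r * r) + (- Cconj a) * z)%C).
    + apply holo_plus; [apply holo_const|apply holo_scal, holo_id].
    + intros z Hz E.
      assert (E' : Cmod (RtoC (r * r)) = Cmod (Cconj a * z)).
      { f_equal; replace (RtoC (r * r)) with (RtoC (r * r) + - Cconj a * z + Cconj a * z)%C by ring.
        rewrite E; ring. }
      rewrite Cmod_mult, Cmod_conj, Cmod_R, Rabs_pos_eq in E' by nra.
      apply Rlt_div_r in Hz; [|exact m0].
      assert (z0 := Cmod_ge_0 z).
      assert (Cmod a * Cmod z <= Cmod z * m) by (unfold m; nra).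
      nra.
Qed.

Lemma is_RInt_lin (f g : R -> R) (a b x y k : R) :
  is_RInt f a b x -> is_RInt g a b y -> is_RInt (fun t => f t + k * g t) a b (x + k * y).
Proof.
  intros Hf Hg; apply (is_RInt_plus (V := R_NormedModule)); [exact Hf|].
  exact (is_RInt_scal (V := R_NormedModule) _ _ _ k _ Hg).
Qed.

Lemma Cmod_Cconj_mult (z : C) : (Cconj z * z)%C = RtoC (Cmod z ^ 2).
Proof. rewrite Cmult_comm; symmetry; apply Cmod2_conj. Qed.

(* Since [F 0 = 0], the quotient [F z / z] is the Poisson integral of its
   values on the circle; no removable singularity has to be filled in. *)
Lemma Schwarz_circle (R0 r M : R) (F F' : C -> C) (a : C) :
  holo R0 F F' -> r < R0 -> F 0%C = 0%C -> Cmod a < r ->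
  (forall t, 0 <= t <= 2 * PI -> Cmod (F (circle r t)) <= M) -> r * Cmod (F a) <= M * Cmod a.
Proof.
  intros HF Hr F0 Ha HM.
  assert (r0 : 0 < r) by (generalize (Cmod_ge_0 a); lra).
  destruct (Ceq_dec a 0%C) as [->|Na]; [rewrite F0, Cmod_0; lra|].
  assert (a0 : 0 < Cmod a) by (apply Cmod_gt_0, Na).
  (* Multiplying by [c] turns the value [F a / a] into [|X|^2], so a bound on a real part bounds a
     modulus. *)
  set (X := (F a / a)%C); set (c := Cconj X).
  assert (HH : holo R0 (fun z => c / a * F z)%C (fun z => c / a * F' z)%C) by apply holo_scal, HF.
  assert (HK : holo R0 (fun z => c * F z)%C (fun z => c * F' z)%C) by apply holo_scal, HF.
  assert (Ea : (c / a * F a)%C = RtoC (Cmod X ^ 2)).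
  { rewrite <- Cmod_Cconj_mult; unfold c, X; field; exact Na. }
  destruct (holo_conj_kernel r a Ha) as (R1 & Q' & HR1 & HQ).
  (* The kernel has mean 1: after conjugation this is the mean value property of a function with
     value 1 at 0. *)
  assert (Q1 : forall d, is_RInt (fun t => Re (d * (circle r t / (circle r t - a)))) 0 (2 * PI)
                 (2 * PI * Re d)).
  { intros d.
    assert (H := mean_value_Re R1 r _ _ (holo_scal _ (Cconj d * RtoC (r * r)) _ _ HQ) (conj r0 HR1)).
    refine (is_RInt_eq _ _ _ _ _ _ _ _ H).
    - intros t.
      rewrite Re_Cauchy_kernel by exact Ha; f_equal; rewrite <- Cmult_assoc; do 3 f_equal; ring.
    - f_equal; rewrite <- (re_conj d); f_equal; field.
      replace (RtoC (r * r) + - Cconj a * 0)%C with (RtoC (r * r)) by ring.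
      intros E; apply RtoC_inj in E; nra. }
  assert (I1 := Cauchy_Re_diff R0 r _ _ a HH Hr Ha); cbv beta in I1.
  assert (I2 := Q1 (c / a * F a)%C); rewrite Ea, re_RtoC in I2; rewrite <- Ea in I2.
  assert (I3 := mean_value_Re R0 r _ _ HH (conj r0 Hr)); cbv beta in I3.
  assert (I4 : is_RInt (fun t =>
              Re (Cconj a * (c * F (circle r t) * / (RtoC (r * r) + - Cconj a * circle r t))))
            0 (2 * PI) 0).
  { assert (Rm : r < Rmin R0 R1) by (apply Rmin_glb_lt; assumption).
    assert (H := mean_value_Re (Rmin R0 R1) r _ _
       (holo_scal _ (Cconj a) _ _ (holo_mult _ _ _ _ _
         (holo_le _ _ _ _ (Rmin_l R0 R1) HK) (holo_le _ _ _ _ (Rmin_r R0 R1) HQ))) (conj r0 Rm)).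
    cbv beta in H; rewrite F0 in H.
    refine (is_RInt_eq _ _ _ _ _ _ (fun t => eq_refl) _ H).
    rewrite Cmult_0_r, Cmult_0_l, Cmult_0_r; simpl; ring. }
  rewrite F0, Cmult_0_r in I3.
  (* With [k = z / (z - a)], the integrand of [I1 + I2 - I3] is the real part of [k] times
     [c F z / z], and [I4] adds that of [Cconj k - 1] times it. The sum is the Poisson integral with
     kernel [k + Cconj k - 1]; only [I2] contributes to its value. *)
  assert (J := is_RInt_lin _ _ _ _ _ _ 1 (is_RInt_lin _ _ _ _ _ _ (-1)
                 (is_RInt_lin _ _ _ _ _ _ 1 I1 I2) I3) I4).
  set (K := Cmod c * (M / r)).
  assert (I5 : is_RInt (fun _ => - K) 0 (2 * PI) ((2 * PI - 0) * - K))
    by exact (is_RInt_const (V := R_NormedModule) 0 (2 * PI) (- K)).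
  (* The comparison integral: the Poisson kernel [2 Re k - 1] has mean 1, and [K] bounds
     [Re (c F z / z)] on the circle. *)
  assert (J' := is_RInt_lin _ _ _ _ _ _ (2 * K) I5 (Q1 1%C)).
  assert (L' : 2 * PI * (Cmod X * Cmod X) <= 2 * PI * K).
  { eapply Rle_trans; [|eapply Rle_trans;
      [apply (is_RInt_le _ _ _ _ _ _ (Rlt_le _ _ Rgt_2PI_0) J J')|]];
      [right; simpl; ring| |right; simpl; ring].
    intros t Ht.
    set (z := circle r t); set (k := (z / (z - a))%C).
    assert (Nz : z <> 0%C) by apply circle_neq_0, r0.
    assert (N := circle_minus_neq_0 r t a Ha); fold z in N.
    assert (N' := Cconj_neq_0 _ N); rewrite Cminus_conj in N'.
    assert (Ep : (k + Cconj k - 1)%C = RtoC (2 * Re k - 1)).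
    { destruct k as [x y]; unfold Cconj, RtoC, Cminus, Cplus, Copp; simpl; f_equal; ring. }
    (* Positivity of the Poisson kernel, in the form [(r^2 - |a|^2) / |z - a|^2]. *)
    assert (Pp : 0 <= 2 * Re k - 1).
    { assert (Ek : (k - 1)%C = (a / (z - a))%C) by (unfold k; field; exact N).
      assert (E1 : Cmod k = r / Cmod (z - a)).
      { unfold k; rewrite Cmod_div by exact N; unfold z; rewrite Cmod_circle; lra. }
      assert (E2 : Cmod (k - 1) = Cmod a / Cmod (z - a)) by (rewrite Ek, Cmod_div by exact N; reflexivity).
      assert (E3 : 2 * Re k - 1 = Cmod k ^ 2 - Cmod (k - 1) ^ 2).
      { rewrite !Cmod2_alt; destruct k as [x y]; simpl; ring. }
      rewrite E3, E1, E2.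
      assert (Nn : 0 < Cmod (z - a)) by (apply Cmod_gt_0, N).
      replace ((r / Cmod (z - a)) ^ 2 - (Cmod a / Cmod (z - a)) ^ 2)
        with ((r ^ 2 - Cmod a ^ 2) / Cmod (z - a) ^ 2) by (field; lra).
      apply Rdiv_le_0_compat; nra. }
    assert (S : Re ((c / a * F z - c / a * F a) * k) + 1 * Re (c / a * F a * k)
        + -1 * Re (c / a * F z) + 1 * Re (Cconj a * (c * F z * / (RtoC (r * r) + - Cconj a * z)))
        = (2 * Re k - 1) * Re (c * F z / z)).
    { transitivity (Re (RtoC (2 * Re k - 1) * (c * F z / z))); [|apply re_scal_l].
      rewrite <- Ep, !Rmult_1_l.
      replace (-1 * Re (c / a * F z)) with (Re (- (c / a * F z))) by (rewrite re_opp; ring).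
      rewrite <- !re_plus; f_equal.
      rewrite <- (circle_conj r t); fold z.
      unfold k; rewrite Cdiv_conj, Cminus_conj by exact N.
      assert (N2 : (Cconj z * z + - Cconj a * z)%C <> 0%C).
      { replace (Cconj z * z + - Cconj a * z)%C with ((Cconj z - Cconj a) * z)%C by ring.
        apply Cmult_neq_0; assumption. }
      field; auto. }
    rewrite S.
    fold z; fold k; replace (- K + 2 * K * Re (1 * k)) with ((2 * Re k - 1) * K)
      by (rewrite Cmult_1_l; ring).
    apply Rmult_le_compat_l; [exact Pp|].
    eapply Rle_trans; [apply Re_le_Cmod_weak|].
    rewrite Cmod_div, Cmod_mult by exact Nz; unfold z at 2; rewrite Cmod_circle by lra.
    unfold K, Rdiv; rewrite Rmult_assoc; apply Rmult_le_compat_l; [apply Cmod_ge_0|].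
    apply Rmult_le_compat_r; [apply Rlt_le, Rinv_0_lt_compat, r0|apply HM; lra]. }
  apply Rmult_le_reg_l in L'; [|apply Rgt_2PI_0].
  unfold K, c in L'; rewrite Cmod_conj in L'.
  assert (EX : Cmod (F a) = Cmod X * Cmod a).
  { unfold X; rewrite Cmod_div by exact Na; field; lra. }
  rewrite EX.
  assert (M0 : 0 <= M) by (eapply Rle_trans; [apply Cmod_ge_0|apply (HM 0); generalize PI_RGT_0; lra]).
  destruct (Req_dec (Cmod X) 0) as [E0|E0].
  - rewrite E0; nra.
  - assert (X0 := Cmod_ge_0 X); assert (X1 : 0 < Cmod X) by lra.
    apply Rmult_le_reg_l in L'; [|exact X1].
    apply Rle_div_r in L'; [|exact r0]; nra.
Qed.

(** * Jack's lemma and mean squares on circles *)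

Lemma continuous_circle_Cmod (R0 r : R) (F F' : C -> C) (t : R) :
  holo R0 F F' -> 0 <= r < R0 -> continuous (fun t => Cmod (F (circle r t))) t.
Proof.
  intros HF Hr; apply (ccont_Cmod (U := R_UniformSpace) (fun t => F (circle r t))).
  apply ccont_comp; [apply ccont_circle, continuous_id|].
  apply (holo_ccont _ _ _ _ HF); rewrite Cmod_circle; lra.
Qed.

Lemma circle_period (r t : R) : circle r (t + 2 * PI) = circle r t.
Proof.
  unfold circle, cis; rewrite cos_plus, sin_plus, cos_2PI, sin_2PI.
  do 2 f_equal; ring.
Qed.

(** Over two periods a maximum found at the end point 0 can be moved to [2 * PI], so it is interior
    and a derivative there must vanish. *)
Lemma periodic_interior_max (f : R -> R) :
  (forall t, continuous f t) -> (forall t, f (t + 2 * PI) = f t) ->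
  exists t0, 0 < t0 < 4 * PI /\ forall t, 0 <= t <= 4 * PI -> f t <= f t0.
Proof.
  intros Hc Hp; assert (P := PI_RGT_0).
  destruct (continuity_ab_maj f 0 (2 * PI)) as [m [Hm Im]]; [lra| |].
  { intros t _; apply continuity_pt_filterlim, Hc. }
  assert (Hm' : forall t, 0 <= t <= 4 * PI -> f t <= f m).
  { intros t Ht; destruct (Rle_dec t (2 * PI)) as [H|H]; [apply Hm; lra|].
    replace t with ((t - 2 * PI) + 2 * PI) by ring; rewrite Hp; apply Hm; lra. }
  destruct (Req_dec m 0) as [E|E].
  - exists (m + 2 * PI); rewrite Hp; split; [lra|exact Hm'].
  - exists m; split; [lra|exact Hm'].
Qed.

Lemma is_derive_Cmod_sq (p : R -> C) (t : R) (d : C) :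
  curve_derive p t d -> is_derive (fun s => Cmod (p s) ^ 2) t (2 * Re (Cconj (p t) * d)).
Proof.
  intros [H1 H2].
  apply (is_derive_ext (fun s => Re (p s) * Re (p s) + Im (p s) * Im (p s))).
  { intros s; rewrite Cmod2_alt; simpl; ring. }
  assert (M : forall g l, is_derive g t l -> is_derive (fun s => g s * g s) t (l * g t + g t * l)).
  { intros g l Hg; exact (is_derive_mult (K := R_AbsRing) g g t l l Hg Hg Rmult_comm). }
  refine (eq_ind _ (fun z => is_derive _ t z)
    (is_derive_plus (V := R_NormedModule) _ _ _ _ _ (M _ _ H1) (M _ _ H2)) _ _).
  change plus with Rplus; destruct (p t), d; simpl; ring.
Qed.

Lemma is_derive_interior_max (f : R -> R) (a b c l : R) :
  a < c < b -> (forall x, a < x < b -> f x <= f c) -> is_derive f c l -> l = 0.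
Proof.
  intros Hc Hm Hd; apply is_derive_Reals in Hd.
  assert (pr : derivable_pt f c) by (exists l; exact Hd).
  rewrite <- (derive_pt_eq_0 f c l pr Hd).
  apply (deriv_maximum f a b c pr); [apply Hc|apply Hc|intros x H1 H2; apply Hm; auto].
Qed.

Lemma is_derive_left_max (f : R -> R) (a b l : R) :
  a < b -> (forall x, a < x < b -> f x <= f b) -> is_derive f b l -> 0 <= l.
Proof.
  intros Hab Hm Hd; destruct (Rle_dec 0 l) as [H|H]; [exact H|exfalso].
  rewrite is_derive_R_eps in Hd.
  assert (e0 : 0 < - l / 2) by lra.
  destruct (Hd (mkposreal _ e0)) as [d Hd']; simpl in Hd'.
  assert (d0 := cond_pos d).
  set (h := Rmin (d / 2) ((b - a) / 2)).
  assert (h0 : 0 < h) by (apply Rmin_pos; lra).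
  assert (h1 : h <= d / 2) by apply Rmin_l; assert (h2 : h <= (b - a) / 2) by apply Rmin_r.
  specialize (Hd' (b - h)); specialize (Hm (b - h)).
  replace (b - h - b) with (- h) in Hd' by ring.
  rewrite Rabs_Ropp, Rabs_pos_eq in Hd' by lra.
  specialize (Hd' ltac:(lra)); specialize (Hm ltac:(lra)).
  apply Rabs_le_between in Hd'; nra.
Qed.

(** At a maximum point of [|W|] on the circle the angular derivative of [|W|^2] vanishes, which
    makes [Cconj W * z W'] real. Schwarz's lemma gives [|W (s z0)| <= s |W z0|], so
    [|W (s z0)|^2 - s^2 |W z0|^2] is maximal at [s = 1] from the left, and its derivative there
    yields the lower bound on [k]. Multiplying by [Cconj (W z0)] instead of dividing by [W z0]
    admits [W z0 = 0]. *)
Lemma Jack (R0 r : R) (W W' : C -> C) :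
  holo R0 W W' -> W 0%C = 0%C -> 0 < r < R0 ->
  exists z0, Cmod z0 = r /\ (forall t, 0 <= t <= 2 * PI -> Cmod (W (circle r t)) <= Cmod (W z0)) /\
    exists k, Cmod (W z0) ^ 2 <= k /\ (Cconj (W z0) * (z0 * W' z0))%C = RtoC k.
Proof.
  intros HW W0 Hr; assert (P := PI_RGT_0).
  destruct (periodic_interior_max (fun t => Cmod (W (circle r t)))) as (t0 & Ht0 & Hm).
  { intros t; apply (continuous_circle_Cmod R0 r W W'); auto; lra. }
  { intros t; rewrite circle_period; reflexivity. }
  set (z0 := circle r t0) in *.
  assert (Ez0 : Cmod z0 = r) by (apply Cmod_circle; lra).
  assert (Hm' : forall t, 0 <= t <= 2 * PI -> Cmod (W (circle r t)) <= Cmod (W z0)).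
  { intros t Ht; apply Hm; lra. }
  exists z0; split; [exact Ez0|split; [exact Hm'|]].
  set (X := (Cconj (W z0) * (z0 * W' z0))%C).
  assert (Dz : cderive W z0 (W' z0)) by (apply HW; lra).
  assert (XI : Im X = 0).
  { assert (D := is_derive_Cmod_sq _ _ _ (curve_derive_comp W (circle r) t0 _ _ Dz (curve_derive_circle r t0))).
    apply (is_derive_interior_max _ 0 (4 * PI)) in D; [|exact Ht0|].
    - cbv beta in D; fold z0 in D.
      replace (Cconj (W z0) * (W' z0 * (Ci * z0)))%C with (X * Ci)%C in D by (unfold X; ring).
      rewrite re_mult_Ci in D; lra.
    - intros t Ht; apply pow_incr; split; [apply Cmod_ge_0|apply Hm; lra]. }
  exists (Re X); split; [|unfold RtoC; rewrite <- XI; destruct X; reflexivity].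
  assert (D : is_derive (fun s => Cmod (W (RtoC s * z0)%C) ^ 2 - s ^ 2 * Cmod (W z0) ^ 2) 1
      (2 * Re X - 2 * Cmod (W z0) ^ 2)).
  { assert (Dp : curve_derive (fun s => RtoC s * z0)%C 1 z0).
    { eapply curve_derive_eq; [apply curve_derive_mult; [apply curve_derive_RtoC|apply curve_derive_const]|].
      cbv beta; ring. }
    assert (Dz' : cderive W (RtoC 1 * z0)%C (W' z0)) by (rewrite Cmult_1_l; exact Dz).
    assert (D1 := is_derive_Cmod_sq _ _ _ (curve_derive_comp W (fun s => RtoC s * z0)%C 1 _ _ Dz' Dp)).
    cbv beta in D1; rewrite Cmult_1_l in D1.
    replace (Cconj (W z0) * (W' z0 * z0))%C with X in D1 by (unfold X; ring).
    apply (is_derive_minus (V := R_NormedModule) _ _ _ _ _ D1).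
    auto_derive; [exact I|ring]. }
  apply (is_derive_left_max _ 0) in D; [lra|lra|].
  intros s Hs; rewrite Cmult_1_l.
  enough (Cmod (W (RtoC s * z0)%C) <= s * Cmod (W z0)).
  { generalize (Cmod_ge_0 (W (RtoC s * z0)%C)); nra. }
  assert (Ea : Cmod (RtoC s * z0)%C = s * r) by (rewrite Cmod_mult, Cmod_R, Rabs_pos_eq, Ez0 by lra; reflexivity).
  assert (S := Schwarz_circle R0 r (Cmod (W z0)) W W' (RtoC s * z0)%C HW (proj2 Hr) W0).
  rewrite Ea in S; specialize (S ltac:(nra) Hm').
  apply (Rmult_le_reg_l r); lra.
Qed.

Definition mean_sq (r : R) (F : C -> C) : R :=
  RInt (fun t => Cmod (F (circle r t)) ^ 2) 0 (2 * PI).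

Lemma mean_sq_correct (R0 r : R) (F F' : C -> C) : holo R0 F F' -> 0 <= r < R0 ->
  is_RInt (fun t => Cmod (F (circle r t)) ^ 2) 0 (2 * PI) (mean_sq r F).
Proof.
  intros HF Hr; apply (RInt_correct (V := R_CompleteNormedModule)), continuous_ex_RInt; intros t.
  assert (H := continuous_circle_Cmod R0 r F F' t HF Hr).
  apply (continuous_ext (fun t => Cmod (F (circle r t)) * Cmod (F (circle r t)))).
  { intros s; simpl; ring. }
  exact (continuous_mult (K := R_AbsRing) _ _ t H H).
Qed.

Lemma mean_sq_ge_0 (R0 r : R) (F F' : C -> C) : holo R0 F F' -> 0 <= r < R0 -> 0 <= mean_sq r F.
Proof.
  intros HF Hr.
  assert (I := is_RInt_const (V := R_NormedModule) 0 (2 * PI) 0).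
  refine (Rle_trans _ _ _ _ (is_RInt_le _ _ _ _ _ _ (Rlt_le _ _ Rgt_2PI_0) I (mean_sq_correct _ _ _ _ HF Hr) _)).
  - right; change (0 = (2 * PI - 0) * 0); ring.
  - intros t _; apply pow_le, Cmod_ge_0.
Qed.

Lemma mean_sq_le (R0 r M : R) (F F' G G' : C -> C) :
  holo R0 F F' -> holo R0 G G' -> 0 <= r < R0 ->
  (forall t, 0 <= t <= 2 * PI -> Cmod (F (circle r t)) <= M * Cmod (G (circle r t))) ->
  mean_sq r F <= M ^ 2 * mean_sq r G.
Proof.
  intros HF HG Hr H.
  refine (is_RInt_le _ _ _ _ _ _ (Rlt_le _ _ Rgt_2PI_0) (mean_sq_correct _ _ _ _ HF Hr)
    (is_RInt_scal (V := R_NormedModule) _ _ _ (M ^ 2) _ (mean_sq_correct _ _ _ _ HG Hr)) _).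
  intros t Ht; change scal with Rmult.
  replace (M ^ 2 * Cmod (G (circle r t)) ^ 2) with ((M * Cmod (G (circle r t))) ^ 2) by ring.
  apply pow_incr; split; [apply Cmod_ge_0|apply H; lra].
Qed.

(** Pythagoras: the cross term [2 Re (Cconj c * F)] has mean value 0 because [F] vanishes at 0. Both
    Bessel's inequality and Littlewood's estimate are iterations of this. *)
Lemma mean_sq_plus_const (R0 r : R) (c : C) (F F' : C -> C) :
  holo R0 F F' -> F 0%C = 0%C -> 0 < r < R0 ->
  mean_sq r (fun z => c + F z)%C = 2 * PI * Cmod c ^ 2 + mean_sq r F.
Proof.
  intros HF F0 Hr; apply is_RInt_unique.
  assert (I1 := mean_value_Re R0 r _ _ (holo_scal _ (Cconj c) _ _ HF) Hr); cbv beta in I1.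
  rewrite F0, Cmult_0_r in I1.
  assert (I2 := mean_sq_correct R0 r F F' HF ltac:(lra)).
  assert (I3 : is_RInt (fun _ => Cmod c ^ 2) 0 (2 * PI) ((2 * PI - 0) * Cmod c ^ 2))
    by exact (is_RInt_const (V := R_NormedModule) 0 (2 * PI) (Cmod c ^ 2)).
  refine (is_RInt_eq _ _ _ _ _ _ _ _ (is_RInt_lin _ _ _ _ _ _ 2 (is_RInt_lin _ _ _ _ _ _ 1 I3 I2) I1)).
  - intros t; destruct (F (circle r t)) as [x y], c as [u v].
    rewrite !Cmod2_alt; simpl; ring.
  - simpl; ring.
Qed.

Lemma mean_sq_id_mult (R0 r : R) (F F' : C -> C) : holo R0 F F' -> 0 <= r < R0 ->
  mean_sq r (fun z => z * F z)%C = r ^ 2 * mean_sq r F.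
Proof.
  intros HF Hr; apply is_RInt_unique.
  refine (is_RInt_eq _ _ _ _ _ _ _ eq_refl
    (is_RInt_scal (V := R_NormedModule) _ _ _ (r ^ 2) _ (mean_sq_correct _ _ _ _ HF Hr))).
  intros t; rewrite Cmod_mult, Cmod_circle by apply Hr; symmetry; apply Rpow_mult_distr.
Qed.

(** * Power series *)

Definition cseries (a : nat -> C) (l : C) : Prop := @is_series C_AbsRing C_NormedModule a l.

Lemma cseries_unique (a : nat -> C) (l l' : C) : cseries a l -> cseries a l' -> l = l'.
Proof. exact (filterlim_locally_unique (V := C_NormedModule) (sum_n a) l l'). Qed.

Lemma cseries_ext (a b : nat -> C) (l : C) : (forall n, a n = b n) -> cseries a l -> cseries b l.
Proof. exact (is_series_ext a b l). Qed.

Lemma cseries_plus (a b : nat -> C) (l m : C) :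
  cseries a l -> cseries b m -> cseries (fun n => a n + b n)%C (l + m)%C.
Proof. exact (is_series_plus a b l m). Qed.

Lemma cseries_scal (c : C) (a : nat -> C) (l : C) : cseries a l -> cseries (fun n => c * a n)%C (c * l)%C.
Proof. exact (is_series_scal c a l). Qed.

Lemma cseries_tail (a : nat -> C) (l : C) : cseries a l -> cseries (fun n => a (S n)) (l - a 0%nat)%C.
Proof.
  intros H; apply (is_series_incr_1 (V := C_NormedModule) a (l - a 0%nat)%C).
  refine (eq_ind l (fun m => cseries a m) H _ _).
  change (l = l - a 0%nat + a 0%nat)%C; ring.
Qed.

Lemma cseries_cons (a : nat -> C) (l : C) : cseries (fun n => a (S n)) l -> cseries a (l + a 0%nat)%C.
Proof.
  intros H; apply (is_series_decr_1 (V := C_NormedModule)).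
  refine (eq_ind l (fun m => cseries _ m) H _ _).
  change (l = l + a 0%nat + - a 0%nat)%C; ring.
Qed.

Lemma cseries_ex (a : nat -> C) (b : nat -> R) :
  (forall n, Cmod (a n) <= b n) -> ex_series b -> exists l, cseries a l.
Proof. exact (ex_series_le (V := C_CompleteNormedModule) a b). Qed.

Lemma cseries_bound (a : nat -> C) (l : C) (b : nat -> R) :
  cseries a l -> (forall n, Cmod (a n) <= b n) -> ex_series b -> Cmod l <= Series b.
Proof.
  intros Ha Hb Eb.
  assert (L : is_lim_seq (fun n => Cmod (sum_n a n)) (Cmod l)).
  { apply (filterlim_comp _ _ _ (sum_n a) Cmod eventually (locally (T := C_UniformSpace) l)).
    - exact Ha.
    - exact (filterlim_norm (V := C_NormedModule) l). }
  refine (is_lim_seq_le _ _ (Cmod l) (Series b) _ L (Series_correct _ Eb)).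
  intros n; eapply Rle_trans; [exact (norm_sum_n_m (V := C_NormedModule) a 0 n)|].
  apply sum_n_m_le; exact Hb.
Qed.

Lemma cseries_bounded (a : nat -> C) (l : C) : cseries a l -> exists M, forall n, Cmod (a n) <= M.
Proof.
  intros Ha.
  assert (B : forall n, exists M, forall k, (k <= n)%nat -> Cmod (a k) <= M).
  { induction n as [|n [M HM]].
    - exists (Cmod (a 0%nat)); intros k Hk; replace k with 0%nat by lia; lra.
    - exists (Rmax M (Cmod (a (S n)))); intros k Hk.
      destruct (Nat.eq_dec k (S n)) as [->|]; [apply Rmax_r|].
      eapply Rle_trans; [apply HM; lia|apply Rmax_l]. }
  assert (Ca : ex_series (V := C_CompleteNormedModule) a) by (exists l; exact Ha).
  apply (Cauchy_ex_series (V := C_CompleteNormedModule)) in Ca.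
  destruct (Ca (mkposreal 1 Rlt_0_1)) as [N HN].
  destruct (B N) as [M HM].
  exists (Rmax M 1); intros n.
  destruct (Nat.le_gt_cases n N) as [H|H].
  - eapply Rle_trans; [apply HM, H|apply Rmax_l].
  - assert (H' := HN n n ltac:(lia) ltac:(lia)); rewrite sum_n_n in H'.
    apply Rlt_le; eapply Rlt_le_trans; [exact H'|apply Rmax_r].
Qed.

Lemma ex_series_eq (a b : nat -> R) : (forall n, a n = b n) -> ex_series a -> ex_series b.
Proof. exact (ex_series_ext a b). Qed.

Definition cps (a : nat -> C) (F : C -> C) : Prop :=
  forall z, Cmod z < 1 -> cseries (fun n => a n * z ^ n)%C (F z).

(** Passing to the real series of moduli makes the invariance of the radius of convergence under
    differentiation available for complex coefficients. *)
Lemma cps_CV_radius (a : nat -> C) (F : C -> C) (x : R) :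
  cps a F -> 0 <= x < 1 -> Rbar_lt (Rabs x) (CV_radius (fun n => Cmod (a n))).
Proof.
  intros H Hx; rewrite Rabs_pos_eq by lra.
  set (y := (x + 1) / 2).
  assert (Hy : Cmod (RtoC y) < 1) by (rewrite Cmod_R, Rabs_pos_eq; unfold y; lra).
  destruct (cseries_bounded _ _ (H _ Hy)) as [M HM].
  apply Rbar_lt_le_trans with y; [simpl; unfold y; lra|].
  apply (proj1 (CV_radius_bounded (fun n => Cmod (a n)))).
  exists M; intros n; eapply Rle_trans; [|apply (HM n)].
  rewrite Cmod_mult, Cmod_pow, Cmod_R, Rabs_mult, <- RPow_abs, (Rabs_pos_eq (Cmod _)) by apply Cmod_ge_0.
  lra.
Qed.

Definition cps_derive (a : nat -> C) (n : nat) : C := (RtoC (INR (S n)) * a (S n))%C.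

Lemma ex_series_CV (a : nat -> R) (x : R) :
  (forall n, 0 <= a n) -> 0 <= x -> Rbar_lt (Rabs x) (CV_radius a) -> ex_series (fun n => a n * x ^ n).
Proof.
  intros Ha Hx H; apply CV_disk_inside in H.
  refine (ex_series_eq _ _ _ H); intros n; apply Rabs_pos_eq.
  apply Rmult_le_pos; [apply Ha|apply pow_le, Hx].
Qed.

Lemma cps_of_coeffs (a : nat -> C) :
  (forall x, 0 <= x < 1 -> ex_series (fun n => Cmod (a n) * x ^ n)) -> exists F, cps a F.
Proof.
  intros H; exists (fun z => iota (T := C_CompleteNormedModule) (cseries (fun n => a n * z ^ n)%C)).
  intros z Hz; apply iota_correct.
  destruct (cseries_ex (fun n => a n * z ^ n)%C (fun n => Cmod (a n) * Cmod z ^ n)) as [l Hl].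
  - intros n; rewrite Cmod_mult, Cmod_pow; lra.
  - apply H; split; [apply Cmod_ge_0|exact Hz].
  - exists l; split; [exact Hl|intros l' Hl'; exact (cseries_unique _ _ _ Hl Hl')].
Qed.

Lemma Cmod_cps_derive (a : nat -> C) (n : nat) :
  Cmod (cps_derive a n) = PS_derive (fun n => Cmod (a n)) n.
Proof.
  unfold cps_derive, PS_derive; rewrite Cmod_mult, Cmod_R, Rabs_pos_eq by apply pos_INR; reflexivity.
Qed.

Lemma cps_derive_ex (a : nat -> C) (F : C -> C) : cps a F -> exists F', cps (cps_derive a) F'.
Proof.
  intros H; apply cps_of_coeffs; intros x Hx.
  apply ex_series_CV; [intros n; apply Cmod_ge_0|lra|].
  rewrite (CV_radius_ext _ _ (Cmod_cps_derive a)), CV_radius_derive.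
  exact (cps_CV_radius _ _ _ H Hx).
Qed.

(** The remainder for exponent [n + 1] is [y] times the one for [n] plus [n z^(n-1) (y - z)^2]. The
    constant is twice the optimal one, so that it is the coefficient of the second derivative of the
    power series. *)
Lemma Cpow_taylor_bound (x : R) (y z : C) (m : nat) : Cmod y <= x -> Cmod z <= x ->
  Cmod (y ^ S (S m) - z ^ S (S m) - (y - z) * (RtoC (INR (S (S m))) * z ^ S m))%C
    <= Cmod (y - z) ^ 2 * (INR (S m) * INR (S (S m)) * x ^ m).
Proof.
  intros Hy Hz; assert (x0 : 0 <= x) by (generalize (Cmod_ge_0 y); lra).
  induction m as [|m IH].
  - replace (y ^ 2 - z ^ 2 - (y - z) * (RtoC (INR 2) * z ^ 1))%C with ((y - z) ^ 2)%C
      by (simpl INR; rewrite RtoC_plus; ring).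
    rewrite Cmod_pow; simpl INR; generalize (pow2_ge_0 (Cmod (y - z))); simpl pow; nra.
  - replace (y ^ S (S (S m)) - z ^ S (S (S m)) - (y - z) * (RtoC (INR (S (S (S m)))) * z ^ S (S m)))%C
      with (y * (y ^ S (S m) - z ^ S (S m) - (y - z) * (RtoC (INR (S (S m))) * z ^ S m))
            + RtoC (INR (S (S m))) * z ^ S m * (y - z) ^ 2)%C
      by (rewrite (S_INR (S (S m))), RtoC_plus, !(Cpow_S _ (S (S m))), !(Cpow_S _ (S m)); ring).
    eapply Rle_trans; [apply Cmod_triangle|].
    rewrite !Cmod_mult, !Cmod_pow, Cmod_R, Rabs_pos_eq by apply pos_INR.
    set (h := Cmod (y - z) ^ 2) in *; assert (h0 : 0 <= h) by apply pow2_ge_0.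
    assert (P1 := Rmult_le_compat _ _ _ _ (Cmod_ge_0 y) (Cmod_ge_0 _) Hy IH).
    assert (P2 : Cmod z ^ S m <= x ^ S m) by (apply pow_incr; split; [apply Cmod_ge_0|exact Hz]).
    assert (n0 := pos_INR (S (S m))).
    assert (P3 : INR (S (S m)) * Cmod z ^ S m * h <= INR (S (S m)) * x ^ S m * h).
    { apply Rmult_le_compat_r; [exact h0|]; apply Rmult_le_compat_l; assumption. }
    eapply Rle_trans; [apply Rplus_le_compat; [exact P1|exact P3]|].
    rewrite !S_INR in *; simpl pow.
    assert (Q : 0 <= h * (x * x ^ m)) by (apply Rmult_le_pos; [exact h0|]; apply (pow_le x (S m) x0)).
    assert (i0 := pos_INR m).
    assert (0 <= h * (x * x ^ m) * (INR m + 1 + 1)) by (apply Rmult_le_pos; lra).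
    nra.
Qed.

(** Summing the Taylor remainders of the powers bounds the error by [|y - z|^2] times the second
    derivative of the series of moduli at a point [x] between [|z|] and 1. *)
Lemma cps_cderive (a : nat -> C) (F F' : C -> C) :
  cps a F -> cps (cps_derive a) F' -> forall z, Cmod z < 1 -> cderive F z (F' z).
Proof.
  intros HF HF' z Hz.
  set (x := (Cmod z + 1) / 2); assert (z0 := Cmod_ge_0 z).
  assert (Hx : 0 <= x < 1) by (unfold x; lra).
  set (b := fun m => Cmod (a (S (S m))) * (INR (S m) * INR (S (S m))) * x ^ m).
  assert (Eb : ex_series b).
  { apply (ex_series_eq (fun n => PS_derive (PS_derive (fun n => Cmod (a n))) n * x ^ n)).
    { intros n; unfold PS_derive, b; ring. }
    apply ex_series_CV; [|apply Hx|].
    - intros n; unfold PS_derive; repeat apply Rmult_le_pos; try apply pos_INR; apply Cmod_ge_0.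
    - rewrite !CV_radius_derive; exact (cps_CV_radius _ _ _ HF Hx). }
  assert (B0 : 0 <= Series b).
  { apply Rle_trans with (Cmod 0); [apply Cmod_ge_0|].
    apply (cseries_bound (fun _ => 0%C) 0%C b); [|intros n; rewrite Cmod_0|exact Eb].
    - apply (cseries_ext (fun n => 0 * (a n * z ^ n))%C); [intros n; ring|].
      exact (eq_ind _ (fun l => cseries _ l) (cseries_scal 0%C _ _ (HF z Hz)) _ (Cmult_0_l _)).
    - unfold b; repeat apply Rmult_le_pos; try apply pos_INR; [apply Cmod_ge_0|apply pow_le, Hx]. }
  assert (T : forall y, Cmod y <= x -> Cmod (F y - F z - (y - z) * F' z) <= Cmod (y - z) ^ 2 * Series b).
  { intros y Hy.
    (* The terms of degree 0 and 1 of the remainder vanish. One tail aligns the index with that of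
       [F'], the second removes the linear term. *)
    assert (C1 := cseries_plus _ _ _ _ (HF y ltac:(lra)) (cseries_scal (-(1))%C _ _ (HF z Hz))).
    apply cseries_tail in C1; cbv beta in C1.
    assert (C2 := cseries_plus _ _ _ _ C1 (cseries_scal (- (y - z))%C _ _ (HF' z Hz))).
    apply cseries_tail in C2; cbv beta in C2.
    rewrite <- Series_scal_l.
    eapply Rle_trans; [|refine (cseries_bound _ _ _ C2 _ (ex_series_scal_l _ _ Eb))].
    - right; f_equal; unfold cps_derive; simpl INR; simpl Cpow; ring.
    - intros n; unfold cps_derive.
      replace (a (S (S n)) * y ^ S (S n) + - (1) * (a (S (S n)) * z ^ S (S n))
         + - (y - z) * (RtoC (INR (S (S n))) * a (S (S n)) * z ^ S n))%C
       with (a (S (S n)) * (y ^ S (S n) - z ^ S (S n) - (y - z) * (RtoC (INR (S (S n))) * z ^ S n)))%C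
       by ring.
      rewrite Cmod_mult; eapply Rle_trans.
      + apply Rmult_le_compat_l; [apply Cmod_ge_0|].
        apply (Cpow_taylor_bound x); [exact Hy|unfold x; lra].
      + right; unfold b; change scal with Rmult; ring. }
  apply cderive_eps; intros eps.
  assert (d0 : 0 < Rmin ((1 - Cmod z) / 2) (eps / (1 + Series b))).
  { apply Rmin_pos; [lra|apply Rdiv_lt_0_compat; [apply cond_pos|lra]]. }
  exists (mkposreal _ d0); simpl; intros y Hy.
  assert (y1 := Rlt_le_trans _ _ _ Hy (Rmin_l _ _)).
  assert (y2 := Rlt_le_trans _ _ _ Hy (Rmin_r _ _)).
  eapply Rle_trans; [apply T|].
  - replace y with ((y - z) + z)%C by ring.
    eapply Rle_trans; [apply Cmod_triangle|unfold x; lra].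
  - apply Rlt_div_r in y2; [|lra].
    assert (h0 := Cmod_ge_0 (y - z)); simpl; rewrite Rmult_1_r.
    rewrite Rmult_assoc, (Rmult_comm eps); apply Rmult_le_compat_l; [exact h0|nra].
Qed.

Lemma cps_holo (a : nat -> C) (F : C -> C) : cps a F -> exists F', cps (cps_derive a) F' /\ holo 1 F F'.
Proof.
  intros H; destruct (cps_derive_ex _ _ H) as [F' H'].
  destruct (cps_derive_ex _ _ H') as [F'' H''].
  exists F'; split; [exact H'|intros z Hz; split].
  - exact (cps_cderive _ _ _ H H' z Hz).
  - exact (cderive_ccont _ _ _ (cps_cderive _ _ _ H' H'' z Hz)).
Qed.

(** * Bessel's inequality and Littlewood subordination *)

Lemma cseries_at_0 (a : nat -> C) (l : C) : cseries (fun n => a n * 0 ^ n)%C l -> l = a 0%nat.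
Proof.
  intros H; apply cseries_tail in H; cbv beta in H.
  assert (H' : cseries (fun n => a (S n) * 0 ^ S n)%C (0 * l)%C).
  { apply (cseries_ext (fun n => 0 * (a (S n) * 0 ^ S n))%C); [intros n; simpl; ring|].
    replace (0 * l)%C with (0 * (l - a 0%nat * 0 ^ 0))%C by ring; apply cseries_scal, H. }
  assert (E := cseries_unique _ _ _ H H'); simpl in E.
  replace l with (l - a 0%nat * 1 + a 0%nat)%C by ring; rewrite E; ring.
Qed.

Lemma cps_at_0 (a : nat -> C) (F : C -> C) : cps a F -> F 0%C = a 0%nat.
Proof. intros H; apply cseries_at_0, H; rewrite Cmod_0; lra. Qed.

Lemma cps_tail (a : nat -> C) (F : C -> C) : cps a F ->
  exists T, cps (fun n => a (S n)) T /\ forall z, Cmod z < 1 -> F z = (a 0%nat + z * T z)%C.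
Proof.
  intros H.
  (* At 0 the quotient takes the value [a 1] that the shifted series has there. *)
  exists (fun z => if Ceq_dec z 0 then a 1%nat else ((F z - a 0%nat) / z)%C); split; intros z Hz;
    destruct (Ceq_dec z 0%C) as [->|Nz].
  - apply (cseries_ext (fun n => match n with O => a 1%nat | S _ => 0%C end)).
    { intros [|n]; simpl; ring. }
    assert (Z : cseries (fun _ => 0%C) 0%C).
    { apply (cseries_ext (fun n => 0 * (a n * 0 ^ n))%C); [intros n; ring|].
      exact (eq_ind _ (fun l => cseries _ l) (cseries_scal 0%C _ _ (H 0%C Hz)) _ (Cmult_0_l _)). }
    exact (eq_ind _ (fun l => cseries _ l)
      (cseries_cons (fun n => match n with O => a 1%nat | S _ => 0%C end) _ Z) _ (Cplus_0_l _)).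
  - assert (T := cseries_scal (/ z)%C _ _ (cseries_tail _ _ (H z Hz))).
    replace ((F z - a 0%nat) / z)%C with (/ z * (F z - a 0%nat * z ^ 0))%C by (simpl; field; exact Nz).
    refine (cseries_ext _ _ _ _ T); intros n; simpl; field; exact Nz.
  - rewrite (cps_at_0 _ _ H); ring.
  - field; exact Nz.
Qed.

Lemma holo_ext (r : R) (F G F' : C -> C) :
  (forall z, Cmod z < r -> F z = G z) -> holo r F F' -> holo r G F'.
Proof.
  intros E H z Hz; destruct (H z Hz) as [D Cc]; split; [|exact Cc].
  assert (d : 0 < r - Cmod z) by lra.
  refine (cderive_ext_loc _ _ _ _ (mkposreal _ d) _ D); simpl; intros y Hy; apply E.
  replace y with (y - z + z)%C by ring; eapply Rle_lt_trans; [apply Cmod_triangle|lra].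
Qed.

Lemma mean_sq_ext (r : R) (F G : C -> C) :
  (forall t, F (circle r t) = G (circle r t)) -> mean_sq r F = mean_sq r G.
Proof. intros E; apply RInt_ext; intros t _; rewrite E; reflexivity. Qed.

(** Write [F = a 0 + z T]: the constant is orthogonal to [z T], the factor [z] has modulus [r] on
    the circle, and [T] has the shifted coefficients. What remains after [N] rounds has a
    nonnegative mean square. *)
Lemma Bessel (N : nat) (a : nat -> C) (F : C -> C) (r : R) : cps a F -> 0 < r < 1 ->
  2 * PI * sum_f_R0 (fun n => Cmod (a n) ^ 2 * r ^ (2 * n)) N <= mean_sq r F.
Proof.
  revert a F; induction N as [|N IH]; intros a F H Hr.
  all: destruct (cps_tail _ _ H) as (T & HT & ET).
  all: destruct (cps_holo _ _ HT) as (T' & _ & HoT).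
  all: assert (Hz := holo_mult _ _ _ _ _ (holo_id 1) HoT); cbv beta in Hz.
  all: rewrite (mean_sq_ext r F (fun z => a 0%nat + z * T z)%C)
         by (intros t; apply ET; rewrite Cmod_circle; lra).
  all: rewrite (mean_sq_plus_const 1 r _ _ _ Hz) by (lra || ring).
  all: rewrite (mean_sq_id_mult 1 r _ _ HoT) by lra.
  all: assert (P := mean_sq_ge_0 1 r _ _ HoT ltac:(lra)); assert (Q := pow2_ge_0 r).
  - simpl sum_f_R0; simpl (2 * 0)%nat; nra.
  - specialize (IH _ _ HT Hr).
    rewrite decomp_sum by lia; simpl (pred (S N)).
    rewrite (sum_eq _ (fun n => Cmod (a (S n)) ^ 2 * r ^ (2 * n) * r ^ 2) N).
    + rewrite <- scal_sum; change (r ^ (2 * 0)) with 1; nra.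
    + intros n _; replace (2 * S n)%nat with (2 * n + 2)%nat by lia; rewrite pow_add; ring.
Qed.

(* Littlewood subordination.  Horner's rule [F = a 0 + u T] peels off one
   coefficient at a time: multiplication by [W] does not increase the mean
   square, and [W T(W)] is orthogonal to the constants. *)
Lemma Littlewood (N : nat) (a : nat -> C) (F W W' : C -> C) (r M e : R) :
  cps a F -> holo 1 W W' -> W 0%C = 0%C -> (forall z, Cmod z < 1 -> Cmod (W z) < 1) ->
  0 < r < 1 -> M < 1 -> (forall t, 0 <= t <= 2 * PI -> Cmod (W (circle r t)) <= M) ->
  (forall n, (N <= n)%nat -> Cmod (a n) <= e) ->
  mean_sq r (fun z => F (W z)) <=
    2 * PI * (sum_f_R0 (fun n => Cmod (a n) ^ 2) N + (e / (1 - M)) ^ 2).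
Proof.
  intros H HW W0 HW1 Hr HM HWM.
  assert (M0 : 0 <= M).
  { eapply Rle_trans; [apply Cmod_ge_0|apply (HWM 0)]; generalize PI_RGT_0; lra. }
  assert (P := PI_RGT_0).
  revert a F H; induction N as [|N IH]; intros a F H He.
  - destruct (cps_holo _ _ H) as (F' & _ & HoF).
    assert (Ho := holo_comp _ _ _ _ _ _ HoF HW HW1).
    (* Every remaining coefficient is at most [e], so [|F (W z)|] is bounded by a geometric series
       of ratio [M]; here the strict bound [M < 1] is essential. *)
    assert (B : mean_sq r (fun z => F (W z)) <= (e / (1 - M)) ^ 2 * mean_sq r (fun _ => 1%C)).
    { apply (mean_sq_le 1 _ _ _ _ _ _ Ho (holo_const 1 1%C)); [lra|].
      intros t Ht; rewrite Cmod_1, Rmult_1_r.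
      assert (Hw := HWM t Ht); set (w := W (circle r t)) in *.
      assert (G : is_series (fun n => e * M ^ n) (e / (1 - M))).
      { apply (is_series_scal (V := R_NormedModule) e).
        apply is_series_geom; rewrite Rabs_pos_eq; lra. }
      rewrite <- (is_series_unique _ _ G).
      apply (cseries_bound _ _ _ (H w ltac:(lra))); [|eexists; exact G].
      intros n; rewrite Cmod_mult, Cmod_pow.
      apply Rmult_le_compat; [apply Cmod_ge_0|apply pow_le, Cmod_ge_0|apply He; lia|].
      apply pow_incr; split; [apply Cmod_ge_0|exact Hw]. }
    assert (E1 : mean_sq r (fun _ => 1%C) = 2 * PI).
    { apply is_RInt_unique.
      refine (is_RInt_eq _ _ _ _ _ _ (fun t => _) _ (is_RInt_const (V := R_NormedModule) 0 (2 * PI) 1)).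
      - rewrite Cmod_1; ring.
      - change ((2 * PI - 0) * 1 = 2 * PI); ring. }
    rewrite E1 in B; simpl sum_f_R0; generalize (pow2_ge_0 (Cmod (a 0%nat))); nra.
  - destruct (cps_tail _ _ H) as (T & HT & ET).
    destruct (cps_holo _ _ HT) as (T' & _ & HoT).
    specialize (IH _ _ HT ltac:(intros n Hn; apply He; lia)).
    assert (HoTW := holo_comp _ _ _ _ _ _ HoT HW HW1).
    assert (Ho := holo_mult _ _ _ _ _ HW HoTW); cbv beta in Ho.
    rewrite (mean_sq_ext r _ (fun z => a 0%nat + W z * T (W z))%C)
      by (intros t; apply ET, HW1; rewrite Cmod_circle; lra).
    rewrite (mean_sq_plus_const 1 r _ _ _ Ho) by (lra || (rewrite W0; ring)).
    assert (B : mean_sq r (fun z => W z * T (W z))%C <= 1 ^ 2 * mean_sq r (fun z => T (W z))).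
    { apply (mean_sq_le 1 _ _ _ _ _ _ Ho HoTW); [lra|].
      intros t Ht; rewrite Cmod_mult; apply Rmult_le_compat_r; [apply Cmod_ge_0|].
      eapply Rle_trans; [apply HWM, Ht|lra]. }
    rewrite decomp_sum by lia; simpl (pred (S N)); nra.
Qed.

(** * The Basel sum *)

(* Goals left by generic Coquelicot lemmas are equalities in the carrier of
   [R_NormedModule], which [ring] does not recognise. *)
Ltac Rring := match goal with |- ?a = ?b => change (@eq R a b) end; ring.

(** Wallis integrals; together with [sq_cos_int] they give Matsuoka's proof of the Basel sum, where
    [1 / n^2] telescopes through the quotients of the two integrals. *)
Definition cos_int (n : nat) : R := RInt (fun x => cos x ^ (2 * n)) 0 (PI / 2).
Definition sq_cos_int (n : nat) : R := RInt (fun x => x ^ 2 * cos x ^ (2 * n)) 0 (PI / 2).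

Lemma ex_derive_ex_RInt (f : R -> R) (a b : R) : (forall x, ex_derive f x) -> ex_RInt f a b.
Proof.
  intros H; apply (ex_RInt_continuous (V := R_CompleteNormedModule)); intros x _.
  apply (ex_derive_continuous f x), H.
Qed.

Lemma cos_int_correct (n : nat) : is_RInt (fun x => cos x ^ (2 * n)) 0 (PI / 2) (cos_int n).
Proof.
  apply (RInt_correct (V := R_CompleteNormedModule)), ex_derive_ex_RInt; intros x; auto_derive; exact I.
Qed.

Lemma sq_cos_int_correct (n : nat) :
  is_RInt (fun x => x ^ 2 * cos x ^ (2 * n)) 0 (PI / 2) (sq_cos_int n).
Proof.
  apply (RInt_correct (V := R_CompleteNormedModule)), ex_derive_ex_RInt; intros x; auto_derive; exact I.
Qed.

Lemma is_RInt_derive_R (f f' : R -> R) (a b : R) :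
  (forall x, is_derive f x (f' x)) -> (forall x, ex_derive f' x) -> is_RInt f' a b (f b - f a).
Proof.
  intros H H'; apply (is_RInt_derive (V := R_CompleteNormedModule) f f').
  - intros x _; apply H.
  - intros x _; apply (ex_derive_continuous f' x), H'.
Qed.

Lemma is_RInt_lin2 (f g h : R -> R) (a b x y k l : R) :
  is_RInt f a b x -> is_RInt g a b y -> (forall t, h t = k * f t + l * g t) ->
  is_RInt h a b (k * x + l * y).
Proof.
  intros Hf Hg E; apply (is_RInt_ext (fun t => k * f t + l * g t)).
  { intros t _; symmetry; apply E. }
  apply (is_RInt_plus (V := R_NormedModule)).
  - exact (is_RInt_scal (V := R_NormedModule) _ _ _ k _ Hf).
  - exact (is_RInt_scal (V := R_NormedModule) _ _ _ l _ Hg).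
Qed.

Lemma is_RInt_ext_unique (f g : R -> R) (a b x y : R) :
  is_RInt f a b x -> is_RInt g a b y -> (forall t, f t = g t) -> x = y.
Proof.
  intros Hf Hg E.
  rewrite <- (is_RInt_unique (V := R_CompleteNormedModule) _ _ _ _ Hf).
  rewrite <- (is_RInt_unique (V := R_CompleteNormedModule) _ _ _ _ Hg).
  apply RInt_ext; intros t _; apply E.
Qed.

Lemma sin_sq (x : R) : sin x ^ 2 = 1 - cos x ^ 2.
Proof. generalize (sin2_cos2 x); unfold Rsqr; intros; simpl; lra. Qed.

(** Integration by parts with primitive [sin x * cos x ^ (2 * n + 1)], which vanishes at both
    ends. *)
Lemma cos_int_S (n : nat) : 2 * INR (S n) * cos_int (S n) = (2 * INR n + 1) * cos_int n.
Proof.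
  assert (H : is_RInt (fun x => 2 * INR (S n) * cos x ^ (2 * S n) - (2 * INR n + 1) * cos x ^ (2 * n))
     0 (PI / 2) (sin (PI / 2) * cos (PI / 2) ^ (2 * n + 1) - sin 0 * cos 0 ^ (2 * n + 1))).
  { apply (is_RInt_derive_R (fun x => sin x * cos x ^ (2 * n + 1))).
    - intros x; auto_derive; [exact I|].
      replace (2 * S n)%nat with (2 * n + 2)%nat by lia.
      change (n + (n + 0))%nat with (2 * n)%nat.
      replace (pred (2 * n + 1)) with (2 * n)%nat by lia.
      rewrite !pow_add, plus_INR, mult_INR, (S_INR n); simpl INR.
      transitivity (cos x ^ (2 * n) * (cos x ^ 2) - (2 * INR n + 1) * cos x ^ (2 * n) * sin x ^ 2);
        [Rring|rewrite sin_sq; Rring].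
    - intros x; auto_derive; exact I. }
  assert (H' := is_RInt_lin2 _ _ _ _ _ _ _ (2 * INR (S n)) (- (2 * INR n + 1))
    (cos_int_correct (S n)) (cos_int_correct n) (fun t => eq_refl)).
  rewrite cos_PI2, sin_0, pow_i in H by lia.
  assert (E := is_RInt_ext_unique _ _ _ _ _ _ H H' ltac:(intros t; cbv beta; ring)); lra.
Qed.

Lemma cos_int_pos (n : nat) : 0 < cos_int n.
Proof.
  induction n as [|n IH].
  - unfold cos_int; simpl; rewrite RInt_const; unfold scal; simpl; unfold mult; simpl.
    generalize PI_RGT_0; lra.
  - assert (E := cos_int_S n); rewrite S_INR in E; assert (P := pos_INR n).
    apply (Rmult_lt_reg_l (2 * (INR n + 1))); [lra|rewrite E, Rmult_0_r].
    apply Rmult_lt_0_compat; lra.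
Qed.

(* Two integrations by parts, packed into one primitive. *)
Lemma cos_int_sq_cos_int (n : nat) :
  cos_int (S n) = INR (S n) * (2 * INR n + 1) * sq_cos_int n - 2 * INR (S n) ^ 2 * sq_cos_int (S n).
Proof.
  remember (INR (S n)) as k eqn:Hk; rewrite S_INR in Hk.
  assert (H : is_RInt (fun x => cos x ^ (2 * S n) +
       (2 * k ^ 2 * (x ^ 2 * cos x ^ (2 * S n)) - k * (2 * INR n + 1) * (x ^ 2 * cos x ^ (2 * n))))
     0 (PI / 2)
       ((PI / 2 * cos (PI / 2) ^ (2 * n + 2) + k * ((PI / 2) ^ 2 * (sin (PI / 2) * cos (PI / 2) ^ (2 * n + 1))))
        - (0 * cos 0 ^ (2 * n + 2) + k * (0 ^ 2 * (sin 0 * cos 0 ^ (2 * n + 1)))))).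
  { apply (is_RInt_derive_R
      (fun x => x * cos x ^ (2 * n + 2) + k * (x ^ 2 * (sin x * cos x ^ (2 * n + 1))))).
    - intros x; auto_derive; [exact I|].
      replace (2 * S n)%nat with (2 * n + 2)%nat by lia.
      change (n + (n + 0))%nat with (2 * n)%nat.
      replace (pred (2 * n + 1)) with (2 * n)%nat by lia.
      replace (pred (2 * n + 2)) with (2 * n + 1)%nat by lia.
      rewrite !pow_add, !plus_INR, mult_INR; simpl INR.
      transitivity (cos x ^ (2 * n) * cos x ^ 2 + k * x ^ 2 * (cos x ^ (2 * n) * cos x ^ 2
         - (2 * INR n + 1) * cos x ^ (2 * n) * sin x ^ 2));
        [rewrite Hk; Rring|rewrite sin_sq, Hk; Rring].
    - intros x; auto_derive; exact I. }
  assert (H' := is_RInt_lin2 _ _ _ _ _ _ _ 1 1 (cos_int_correct (S n))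
     (is_RInt_lin2 _ _ _ _ _ _ _ (2 * k ^ 2) (- (k * (2 * INR n + 1)))
       (sq_cos_int_correct (S n)) (sq_cos_int_correct n) (fun t => eq_refl)) (fun t => eq_refl)).
  rewrite cos_PI2, sin_0, !pow_i in H by lia.
  assert (E := is_RInt_ext_unique _ _ _ _ _ _ H H' ltac:(intros t; cbv beta; ring)); lra.
Qed.

(** Concavity: if [PI / 2 * sin t - t] were negative at [x], its slope would be negative somewhere
    before [x] and positive somewhere after it, whereas the cosine decreases. *)
Lemma jordan_sin (x : R) : 0 <= x <= PI / 2 -> x <= PI / 2 * sin x.
Proof.
  intros Hx; assert (P := PI_RGT_0).
  destruct (Rle_dec x (PI / 2 * sin x)) as [H|H]; [exact H|exfalso].
  assert (x0 : 0 < x) by (destruct (Req_dec x 0) as [E|E]; [rewrite E, sin_0 in H; lra|lra]).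
  assert (x1 : x < PI / 2).
  { destruct (Req_dec x (PI / 2)) as [E|E]; [rewrite E, sin_PI2 in H; lra|lra]. }
  set (g := fun t => PI / 2 * sin t - t).
  assert (D : forall t, is_derive g t (PI / 2 * cos t - 1)).
  { intros t; unfold g; auto_derive; [exact I|ring]. }
  assert (M : forall a b, a < b -> exists c, a <= c <= b /\ g b - g a = (PI / 2 * cos c - 1) * (b - a)).
  { intros a b Hab; destruct (MVT_gen g a b (fun t => PI / 2 * cos t - 1)) as [c [Hc E]].
    - intros t _; apply D.
    - intros t _; apply continuity_pt_filterlim, (ex_derive_continuous g); eexists; apply D.
    - rewrite Rmin_left, Rmax_right in Hc by lra; exists c; auto. }
  destruct (M 0 x x0) as [c1 [Hc1 E1]]; destruct (M x (PI / 2) x1) as [c2 [Hc2 E2]].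
  unfold g in E1, E2; rewrite sin_0 in E1; rewrite sin_PI2 in E2.
  assert (cos c2 <= cos c1) by (apply cos_decr_1; lra).
  assert (PI / 2 * cos c1 - 1 < 0) by nra.
  assert (0 < PI / 2 * cos c2 - 1) by nra.
  nra.
Qed.

Lemma sq_cos_int_bound (n : nat) :
  0 <= sq_cos_int n <= PI ^ 2 / 4 * (cos_int n - cos_int (S n)).
Proof.
  assert (P := PI_RGT_0); split.
  - refine (Rle_trans _ _ _ _ (is_RInt_le _ _ 0 (PI / 2) _ _ _
      (is_RInt_const (V := R_NormedModule) 0 (PI / 2) 0) (sq_cos_int_correct n) _)).
    + right; change (0 = (PI / 2 - 0) * 0); ring.
    + lra.
    + intros x _; rewrite pow_mult; apply Rmult_le_pos; [apply pow2_ge_0|apply pow_le, pow2_ge_0].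
  - replace (PI ^ 2 / 4 * (cos_int n - cos_int (S n)))
      with (PI ^ 2 / 4 * cos_int n + - (PI ^ 2 / 4) * cos_int (S n)) by ring.
    refine (is_RInt_le _ _ 0 (PI / 2) _ _ _ (sq_cos_int_correct n)
      (is_RInt_lin2 _ _ _ _ _ _ _ _ _ (cos_int_correct n) (cos_int_correct (S n)) (fun t => eq_refl)) _); [lra|].
    intros x Hx.
    replace (PI ^ 2 / 4 * cos x ^ (2 * n) + - (PI ^ 2 / 4) * cos x ^ (2 * S n))
      with ((PI / 2 * sin x) ^ 2 * cos x ^ (2 * n)).
    + apply Rmult_le_compat_r; [rewrite pow_mult; apply pow_le, pow2_ge_0|].
      apply pow_incr; split; [lra|apply jordan_sin; lra].
    + replace (2 * S n)%nat with (2 * n + 2)%nat by lia; rewrite pow_add, Rpow_mult_distr, sin_sq; field.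
Qed.

Lemma Basel : is_series (fun n : nat => 1 / INR (S n) ^ 2) (PI ^ 2 / 6).
Proof.
  set (K := fun n => sq_cos_int n / cos_int n).
  (* Divide [cos_int_sq_cos_int] by [(n + 1)^2 * cos_int (S n)] and turn [cos_int (S n)] into
     [cos_int n] by the Wallis recursion. *)
  assert (S1 : forall n, 1 / INR (S n) ^ 2 = 2 * (K n - K (S n))).
  { intros n; unfold K.
    assert (E1 := cos_int_S n); assert (E2 := cos_int_sq_cos_int n).
    assert (P1 := cos_int_pos n); assert (P2 := cos_int_pos (S n)).
    rewrite S_INR in *; assert (Pn := pos_INR n).
    set (m := INR n) in *.
    assert (E3 : sq_cos_int n / cos_int n = (2 * m + 1) / (2 * (m + 1)) * sq_cos_int n / cos_int (S n)).
    { replace (cos_int n) with (2 * (m + 1) * cos_int (S n) / (2 * m + 1)) by (rewrite E1; field; lra).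
      field; repeat split; lra. }
    rewrite E3.
    apply (Rmult_eq_reg_r ((m + 1) ^ 2 * cos_int (S n))).
    - transitivity (cos_int (S n)); [field; lra|].
      rewrite E2 at 1; field; lra.
    - apply Rgt_not_eq, Rmult_lt_0_compat; [apply pow_lt; lra|exact P2]. }
  assert (S2 : forall n, sum_n (fun n => 1 / INR (S n) ^ 2) n = 2 * (K 0%nat - K (S n))).
  { induction n as [|n IH].
    - rewrite sum_O; apply S1.
    - rewrite sum_Sn, IH, S1; change plus with Rplus; Rring. }
  assert (K0 : 2 * K 0%nat = PI ^ 2 / 6).
  { unfold K.
    assert (A : cos_int 0 = PI / 2).
    { unfold cos_int; simpl; rewrite RInt_const; unfold scal; simpl; unfold mult; simpl; field. }
    assert (B : sq_cos_int 0 = PI ^ 3 / 24).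
    { apply is_RInt_unique.
      replace (PI ^ 3 / 24) with ((PI / 2) ^ 3 / 3 - 0 ^ 3 / 3) by field.
      apply (is_RInt_derive_R (fun x => x ^ 3 / 3)).
      - intros x; auto_derive; [exact I|simpl; field].
      - intros x; auto_derive; exact I. }
    rewrite A, B; field; generalize PI_RGT_0; lra. }
  assert (KL : is_lim_seq K 0).
  { apply (is_lim_seq_le_le (fun _ => 0) K (fun n => PI ^ 2 / 8 * / (INR n + 1))).
    - intros n; destruct (sq_cos_int_bound n) as [B1 B2].
      assert (P1 := cos_int_pos n); assert (E1 := cos_int_S n); rewrite S_INR in E1.
      assert (Pn := pos_INR n); unfold K; split; [apply Rdiv_le_0_compat; lra|].
      apply Rle_div_l; [exact P1|]; eapply Rle_trans; [exact B2|right].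
      replace (cos_int (S n)) with ((2 * INR n + 1) / (2 * (INR n + 1)) * cos_int n).
      + field; lra.
      + apply (Rmult_eq_reg_l (2 * (INR n + 1))); [rewrite E1; field; lra|lra].
    - apply is_lim_seq_const.
    - replace (Finite 0) with (Rbar_mult (PI ^ 2 / 8) (Rbar_inv p_infty)) by (simpl; f_equal; ring).
      apply (is_lim_seq_scal_l (fun n => / (INR n + 1)) (PI ^ 2 / 8) (Rbar_inv p_infty)).
      apply is_lim_seq_inv; [|discriminate].
      apply (is_lim_seq_ext (fun n => INR (S n))); [intros n; apply S_INR|].
      apply (is_lim_seq_incr_1 INR), is_lim_seq_INR. }
  apply (is_lim_seq_ext (fun n => 2 * (K 0%nat - K (S n)))) with (l := PI ^ 2 / 6).
  { intros n; symmetry; apply S2. }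
  rewrite <- K0; replace (2 * K 0%nat) with (2 * (K 0%nat - 0)) by ring.
  apply (is_lim_seq_scal_l _ 2 (K 0%nat - 0)).
  apply is_lim_seq_minus'; [apply is_lim_seq_const|apply (is_lim_seq_incr_1 K), KL].
Qed.

(** * Logarithms *)

(** Coefficients of [- log (1 - u)]; the convention [/ 0 = 0] supplies the correct constant
    coefficient. *)
Definition inv_nat (n : nat) : C := RtoC (/ INR n).

Lemma Cmod_inv_nat (n : nat) : Cmod (inv_nat n) = / INR n.
Proof.
  unfold inv_nat; rewrite Cmod_R; apply Rabs_pos_eq.
  destruct n as [|n]; [simpl; rewrite Rinv_0; lra|].
  apply Rlt_le, Rinv_0_lt_compat, lt_0_INR; lia.
Qed.

Lemma inv_nat_0 : inv_nat 0 = 0%C.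
Proof. unfold inv_nat; simpl; rewrite Rinv_0; reflexivity. Qed.

Lemma inv_nat_le (m n : nat) : (m <= n)%nat -> Cmod (inv_nat (S n)) <= / INR (S m).
Proof.
  intros H; rewrite Cmod_inv_nat; apply Rinv_le_contravar; [apply lt_0_INR; lia|apply le_INR; lia].
Qed.

Lemma Cneq_1_of_Cmod (z : C) : Cmod z < 1 -> (1 - z <> 0)%C.
Proof.
  intros Hz E; apply (Rlt_irrefl 1); rewrite <- Cmod_1 at 1.
  replace (RtoC 1) with z; [exact Hz|].
  replace z with (1 - (1 - z))%C by ring; rewrite E; ring.
Qed.

Lemma cseries_geom (z l : C) : Cmod z < 1 -> cseries (fun n => z ^ n)%C l -> l = (/ (1 - z))%C.
Proof.
  intros Hz H; assert (N := Cneq_1_of_Cmod z Hz).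
  assert (E := cseries_unique _ _ _ (cseries_tail _ _ H) (cseries_scal z _ _ H)); simpl in E.
  replace l with ((l - z * l) / (1 - z))%C by (field; exact N).
  replace (l - z * l)%C with (RtoC 1); [field; exact N|].
  rewrite <- E; ring.
Qed.

(** Termwise differentiation gives [L' = 1 / (1 - z)], so [(1 - z) * Cexp (L z)] has derivative 0
    and keeps its value 1 at 0. *)
Lemma log_series : exists L, cps inv_nat L /\
  forall z, Cmod z < 1 -> Cexp (L z) = (/ (1 - z))%C.
Proof.
  destruct (cps_of_coeffs inv_nat) as [L HL].
  { intros x Hx.
    refine (ex_series_le (K := R_AbsRing) (V := R_CompleteNormedModule) _ (fun n => x ^ n) _ _).
    - intros n; assert (P : 0 <= x ^ n) by (apply pow_le; lra).
      change (Rabs (Cmod (inv_nat n) * x ^ n) <= x ^ n).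
      rewrite Rabs_pos_eq by (apply Rmult_le_pos; [apply Cmod_ge_0|exact P]).
      rewrite <- (Rmult_1_l (x ^ n)) at 2; apply Rmult_le_compat_r; [exact P|].
      destruct n as [|n]; [rewrite inv_nat_0, Cmod_0; lra|].
      rewrite <- Rinv_1; apply (inv_nat_le 0); lia.
    - apply ex_series_geom; rewrite Rabs_pos_eq; lra. }
  exists L; split; [exact HL|].
  destruct (cps_holo _ _ HL) as (L' & HL' & HoL).
  assert (EL' : forall z, Cmod z < 1 -> L' z = (/ (1 - z))%C).
  { intros z Hz; apply (cseries_geom z _ Hz).
    refine (cseries_ext _ _ _ _ (HL' z Hz)); intros n; unfold cps_derive, inv_nat.
    rewrite <- RtoC_mult, Rinv_r by (apply not_0_INR; lia); ring. }
  assert (Ho := holo_mult _ _ _ _ _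
    (holo_plus 1 _ _ _ _ (holo_const 1 1%C) (holo_scal 1 (-(1))%C _ _ (holo_id 1)))
    (holo_Cexp_comp _ _ _ HoL)); cbv beta in Ho.
  intros z Hz; assert (N := Cneq_1_of_Cmod z Hz).
  assert (E := holo_const_of_derive_0 1 _ _ Ho).
  cbv beta in E; rewrite (cps_at_0 _ _ HL), inv_nat_0, Cexp_0 in E.
  assert (E' := E ltac:(intros y Hy; rewrite EL' by exact Hy; field; apply Cneq_1_of_Cmod, Hy) z Hz).
  replace (Cexp (L z)) with ((1 + - (1) * z) * Cexp (L z) / (1 - z))%C by (field; exact N).
  rewrite E'; field; exact N.
Qed.

(* A continuous logarithm of 1 vanishing at 0 takes no value [i y] with
   [0 < |y| <= pi], so by the intermediate value theorem along rays it is 0. *)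
Lemma continuous_log_one (d : C -> C) :
  (forall z, Cmod z < 1 -> ccont d z) -> d 0%C = 0%C ->
  (forall z, Cmod z < 1 -> Cexp (d z) = 1%C) -> forall z, Cmod z < 1 -> d z = 0%C.
Proof.
  intros Hc H0 He z Hz.
  assert (P := PI_RGT_0).
  assert (Hex : forall w, Cexp w = 1%C -> Re w = 0 /\ cos (Im w) = 1).
  { intros w Hw; assert (E1 : exp (Re w) * cos (Im w) = 1) by (injection Hw; auto).
    assert (E2 : exp (Re w) * sin (Im w) = 0) by (injection Hw; auto).
    assert (Ep := exp_pos (Re w)).
    assert (S0 : sin (Im w) = 0) by (apply Rmult_integral in E2; lra).
    assert (T := sin2_cos2 (Im w)); rewrite S0 in T; unfold Rsqr in T.
    assert (Cc : cos (Im w) = 1) by nra.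
    rewrite Cc, Rmult_1_r in E1; split; [|exact Cc].
    apply exp_inv; rewrite E1, exp_0; reflexivity. }
  assert (Hs : forall s, 0 <= s <= 1 -> Cmod (RtoC s * z)%C < 1).
  { intros s Hs; rewrite Cmod_mult, Cmod_R, Rabs_pos_eq by lra; generalize (Cmod_ge_0 z); nra. }
  assert (Cs : forall s, 0 <= s <= 1 -> continuous (fun s => Im (d (RtoC s * z)%C)) s).
  { intros s Hs'.
    apply (ccont_Re_Im (U := R_UniformSpace) (fun s => d (RtoC s * z)%C)).
    apply (ccont_comp d (fun s : R_UniformSpace => (RtoC s * z)%C)); [|apply Hc, Hs, Hs'].
    apply ccont_mult; [apply ccont_RtoC, continuous_id|apply ccont_const]. }
  assert (V : forall k, Rabs k = 1 -> k * Im (d z) <= 0).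
  { intros k Hk; destruct (Rle_dec (k * Im (d z)) 0) as [|N]; [assumption|exfalso].
    (* A value strictly between 0 and [k * Im (d z)], hence attained on the ray, and in the range
       where the cosine is injective; the sign [k] treats both half-lines at once. *)
    set (y := Rmin (k * Im (d z)) PI / 2).
    assert (Hy : 0 < y < k * Im (d z) /\ y <= PI).
    { unfold y, Rmin; destruct Rle_dec; lra. }
    destruct (IVT_interv (fun s => k * Im (d (RtoC s * z)%C) - y) 0 1) as [s [Hs1 Hs2]].
    - intros s Hs'; apply continuity_pt_minus; [|apply continuity_pt_const; intros u v; reflexivity].
      apply continuity_pt_scal, continuity_pt_filterlim, Cs, Hs'.
    - lra.
    - rewrite Cmult_0_l, H0; simpl; lra.
    - rewrite Cmult_1_l; lra.
    - destruct (Hex _ (He _ (Hs s Hs1))) as [_ Hcos].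
      set (x := Im (d (RtoC s * z)%C)) in *.
      assert (Ec : cos (k * x) = 1).
      { destruct (Req_dec k 1) as [->|]; [rewrite Rmult_1_l; exact Hcos|].
        replace k with (-1) by (unfold Rabs in Hk; destruct Rcase_abs; lra).
        replace (-1 * x) with (- x) by ring; rewrite cos_neg; exact Hcos. }
      rewrite <- cos_0 in Ec; apply cos_inj in Ec; lra. }
  assert (V1 := V 1 Rabs_R1); assert (V2 := V (-1) ltac:(unfold Rabs; destruct Rcase_abs; lra)).
  destruct (Hex _ (He z Hz)) as [HR _].
  apply injective_projections; [exact HR|change (Im (d z) = 0); lra].
Qed.

Lemma Cexp_branch_unique (g1 g2 : C -> C) :
  (forall z, Cmod z < 1 -> ccont g1 z) -> (forall z, Cmod z < 1 -> ccont g2 z) ->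
  g1 0%C = g2 0%C -> (forall z, Cmod z < 1 -> Cexp (g1 z) = Cexp (g2 z)) ->
  forall z, Cmod z < 1 -> g1 z = g2 z.
Proof.
  intros C1 C2 E0 E z Hz; apply Ceq_minus.
  apply (continuous_log_one (fun z => g1 z - g2 z)%C); auto.
  - intros y Hy; apply ccont_minus; auto.
  - rewrite E0; ring.
  - intros y Hy; unfold Cminus; rewrite Cexp_plus, Cexp_opp, E by exact Hy.
    field; apply Cexp_neq_0.
Qed.

(** Bessel's inequality for the difference of the two series: its mean square on the circle of
    radius 1/2 is 0, so every coefficient is. *)
Lemma cps_unique (a b : nat -> C) (F : C -> C) : cps a F -> cps b F -> forall n, a n = b n.
Proof.
  intros Ha Hb n.
  assert (Hd : cps (fun n => a n + - (1) * b n)%C (fun z => F z + - (1) * F z)%C).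
  { intros z Hz.
    refine (cseries_ext _ _ _ _ (cseries_plus _ _ _ _ (Ha z Hz) (cseries_scal (-(1))%C _ _ (Hb z Hz)))).
    intros k; ring. }
  assert (Bs := Bessel n _ _ (/ 2) Hd ltac:(lra)).
  assert (Z : mean_sq (/ 2) (fun z => F z + - (1) * F z)%C = 0).
  { apply is_RInt_unique.
    refine (is_RInt_eq _ _ _ _ _ _ _ _ (is_RInt_const (V := R_NormedModule) 0 (2 * PI) 0)).
    - intros t; replace (F (circle (/ 2) t) + - (1) * F (circle (/ 2) t))%C with (RtoC 0) by ring.
      rewrite Cmod_0; ring.
    - change ((2 * PI - 0) * 0 = 0); ring. }
  rewrite Z in Bs.
  set (u := fun n => Cmod (a n + - (1) * b n)%C ^ 2 * (/ 2) ^ (2 * n)) in Bs.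
  assert (u0 : forall k, 0 <= u k).
  { intros k; apply Rmult_le_pos; [apply pow2_ge_0|apply pow_le; lra]. }
  assert (Un : u n <= sum_f_R0 u n).
  { destruct n as [|n]; [simpl; lra|]; simpl.
    assert (0 <= sum_f_R0 u n) by (apply cond_pos_sum, u0); lra. }
  assert (E : u n = 0) by (generalize (u0 n) Rgt_2PI_0; nra).
  apply Rmult_integral in E; destruct E as [E|E]; [|apply pow_nonzero in E; [contradiction|lra]].
  apply Ceq_minus, Cmod_eq_0.
  replace (a n - b n)%C with (a n + - (1) * b n)%C by ring.
  generalize (Cmod_ge_0 (a n + - (1) * b n)%C); simpl in E; nra.
Qed.

Lemma cps_dilate (a : nat -> C) (F : C -> C) (c : C) : cps a F -> Cmod c <= 1 ->
  cps (fun n => a n * c ^ n)%C (fun z => F (c * z)%C).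
Proof.
  intros H Hc z Hz.
  assert (Hcz : Cmod (c * z)%C < 1).
  { rewrite Cmod_mult; generalize (Cmod_ge_0 c) (Cmod_ge_0 z); nra. }
  refine (cseries_ext _ _ _ _ (H _ Hcz)); intros n; rewrite Cpow_mult_l; ring.
Qed.

Lemma cps_plus (a b : nat -> C) (F G : C -> C) : cps a F -> cps b G ->
  cps (fun n => a n + b n)%C (fun z => F z + G z)%C.
Proof.
  intros Ha Hb z Hz.
  refine (cseries_ext _ _ _ _ (cseries_plus _ _ _ _ (Ha z Hz) (Hb z Hz))); intros n; ring.
Qed.

Lemma cps_scal (c : C) (a : nat -> C) (F : C -> C) : cps a F ->
  cps (fun n => c * a n)%C (fun z => c * F z)%C.
Proof.
  intros Ha z Hz; refine (cseries_ext _ _ _ _ (cseries_scal c _ _ (Ha z Hz))); intros n; ring.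
Qed.

Lemma cps_ccont (a : nat -> C) (F : C -> C) (z : C) : cps a F -> Cmod z < 1 -> ccont F z.
Proof. intros H Hz; destruct (cps_holo _ _ H) as (F' & _ & Ho); exact (holo_ccont _ _ _ _ Ho Hz). Qed.

Lemma log_coeffs_of_cps (f G : C -> C) (a : nat -> C) :
  cps a G -> a 0%nat = 0%C ->
  (forall z, Cmod z < 1 -> z <> 0%C -> Cexp (2 * G z)%C = (f z / z)%C) -> log_coeffs f a.
Proof.
  intros H a0 He; exists (fun z => 2 * G z)%C; split; [split; [|split]|].
  - intros z Hz; apply (ccont_mult (U := C_UniformSpace)); [apply ccont_const|].
    exact (cps_ccont _ _ _ H Hz).
  - rewrite (cps_at_0 _ _ H), a0; ring.
  - exact He.
  - intros z Hz; replace (1 / 2 * (2 * G z))%C with (G z - a 0%nat * z ^ 0)%C.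
    + exact (cseries_tail _ _ (H z Hz)).
    + rewrite a0; simpl; field.
Qed.

(** The value [gamma 0] is arbitrary, so it is replaced by 0 to obtain a power series indexed from 0
    for half the logarithm. *)
Lemma log_coeffs_cps (f : C -> C) (gamma : nat -> C) : log_coeffs f gamma ->
  exists G a, cps a G /\ a 0%nat = 0%C /\ (forall n, a (S n) = gamma (S n)) /\
    forall z, Cmod z < 1 -> z <> 0%C -> Cexp (2 * G z)%C = (f z / z)%C.
Proof.
  intros (g & (gc & g0 & ge) & gs).
  exists (fun z => 1 / 2 * g z)%C, (fun n => match n with O => RtoC 0 | S _ => gamma n end).
  split; [|split; [reflexivity|split; [reflexivity|]]].
  - intros z Hz.
    assert (T := cseries_cons (fun n => (match n with O => RtoC 0 | S _ => gamma n end) * z ^ n)%C _ (gs z Hz)).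
    refine (eq_ind _ (fun l => cseries _ l) T _ _); simpl; ring.
  - intros z Hz Nz; rewrite <- ge by assumption; f_equal; field.
Qed.

(** Membership test in terms of [h = z / f z], for which the defining expression becomes linear in
    [h]; it serves both explicit functions. *)
Lemma class_U_quotient (h h' : C -> C) :
  (forall z, Cmod z < 1 -> cderive h z (h' z)) -> h 0%C = 1%C ->
  (forall z, Cmod z < 1 -> h z <> 0%C) ->
  (forall z, Cmod z < 1 -> z <> 0%C -> Cmod (h z - z * h' z - 1)%C < 1) ->
  class_U (fun z => z / h z)%C.
Proof.
  intros D h0 N B.
  assert (Df : forall z, Cmod z < 1 -> cderive (fun z => z / h z)%C z ((h z - z * h' z) / (h z * h z))%C).
  { intros z Hz; eapply cderive_eq.
    - apply cderive_mult; [apply cderive_id|].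
      apply cderive_comp; [apply cderive_Cinv, N, Hz|apply D, Hz].
    - cbv beta; field; apply N, Hz. }
  assert (Z0 : Cmod 0 < 1) by (rewrite Cmod_0; lra).
  split; [split; [|split]|].
  - intros z Hz; eexists; apply Df, Hz.
  - rewrite h0; field.
  - rewrite (cderive_unique _ _ _ (Df 0%C Z0)), h0; field.
  - intros z Hz Nz; assert (Nh := N z Hz); split.
    + intros E; apply Nz; replace z with (z / h z * h z)%C by (field; exact Nh); rewrite E; ring.
    + rewrite (cderive_unique _ _ _ (Df z Hz)).
      replace ((z / (z / h z)) ^ 2 * ((h z - z * h' z) / (h z * h z)) - 1)%C with (h z - z * h' z - 1)%C.
      * apply B; assumption.
      * field; auto.
Qed.

(** * The class U *)

(* With [omega = 1 - exp (- G)], where [G] is half of [log (f z / z)], the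
   quantity bounded by 1 in [class_U] is [(1 - omega)^2 + 2 (1 - omega) z omega' - 1].
   At a point where [|omega|] is maximal on a circle, Jack's lemma gives
   [z omega' = k omega] with [k >= 1], and the quantity is
   [2 (k - 1) omega - (2 k - 1) omega^2]. *)
Lemma Jack_class_U (W W' : C -> C) (r : R) :
  holo 1 W W' -> W 0%C = 0%C -> 0 < r < 1 ->
  (forall z, Cmod z < 1 -> z <> 0%C ->
     Cmod ((1 - W z) ^ 2 + 2 * (1 - W z) * (z * W' z) - 1)%C < 1) ->
  exists M, 0 <= M < 1 /\ forall t, 0 <= t <= 2 * PI -> Cmod (W (circle r t)) <= M.
Proof.
  intros HW W0 Hr HU.
  destruct (Jack 1 r W W' HW W0 Hr) as (z0 & Ez & Hm & k & Hk & Ek).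
  exists (Cmod (W z0)); split; [split; [apply Cmod_ge_0|]|exact Hm].
  apply Rnot_le_lt; intros M1.
  assert (Nz : z0 <> 0%C) by (apply Cmod_gt_0; lra).
  specialize (HU z0 ltac:(lra) Nz); apply Rlt_not_le in HU; apply HU; clear HU.
  set (w := W z0) in *; set (m := Cmod w) in *.
  assert (Nw : w <> 0%C) by (apply Cmod_gt_0; fold m; lra).
  (* Dividing the conclusion of [Jack] by [|w|^2] gives the multiplier in [z0 * W' z0 = l * w], with
     [l >= 1]. *)
  set (l := k / m ^ 2).
  assert (m2 : 0 < m ^ 2) by (apply pow_lt; lra).
  assert (l1 : 1 <= l) by (apply Rle_div_r; lra).
  assert (El : (z0 * W' z0)%C = (RtoC l * w)%C).
  { assert (Nc := Cconj_neq_0 _ Nw).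
    replace (z0 * W' z0)%C with (Cconj w * (z0 * W' z0) / Cconj w)%C by (field; exact Nc).
    rewrite Ek; replace k with (l * m ^ 2) by (unfold l; field; lra).
    rewrite RtoC_mult; unfold m; rewrite <- Cmod_Cconj_mult; field; exact Nc. }
  rewrite El.
  replace ((1 - w) ^ 2 + 2 * (1 - w) * (RtoC l * w) - 1)%C
    with (w * (RtoC (2 * (l - 1)) - RtoC (2 * l - 1) * w))%C
    by (rewrite !RtoC_minus, !RtoC_mult, RtoC_minus; ring).
  rewrite Cmod_mult; fold m.
  (* Reverse triangle inequality: [q >= (2 l - 1) m - 2 (l - 1) >= 1] when [m >= 1], so the modulus
     [m * q] is at least 1, against the class condition. *)
  assert (T := Cmod_triangle (RtoC (2 * (l - 1)) - RtoC (2 * l - 1) * w) (- RtoC (2 * (l - 1)))).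
  replace (RtoC (2 * (l - 1)) - RtoC (2 * l - 1) * w + - RtoC (2 * (l - 1)))%C
    with (- (RtoC (2 * l - 1) * w))%C in T by ring.
  rewrite !Cmod_opp, Cmod_mult, !Cmod_R, !Rabs_pos_eq in T by lra; fold m in T.
  set (q := Cmod (RtoC (2 * (l - 1)) - RtoC (2 * l - 1) * w)) in *; clearbody q.
  assert (0 <= (2 * l - 1) * (m - 1)) by (apply Rmult_le_pos; lra).
  assert (1 <= q) by lra; nra.
Qed.

Lemma sum_inv_nat_le (N : nat) : sum_f_R0 (fun n => Cmod (inv_nat n) ^ 2) N <= PI ^ 2 / 6.
Proof.
  assert (Pos : forall n, 0 <= 1 / INR (S n) ^ 2).
  { intros n; apply Rdiv_le_0_compat; [lra|apply pow_lt, lt_0_INR; lia]. }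
  apply Rle_trans with (sum_f_R0 (fun n => Cmod (inv_nat n) ^ 2) (S N)).
  { simpl; generalize (pow2_ge_0 (Cmod (inv_nat (S N)))); simpl; lra. }
  rewrite decomp_sum by lia; simpl (pred (S N)).
  rewrite inv_nat_0, Cmod_0, pow_i, Rplus_0_l by lia.
  rewrite (sum_eq _ (fun n => 1 / INR (S n) ^ 2)).
  - assert (B := Basel).
    rewrite <- sum_n_Reals.
    apply (is_lim_seq_incr_compare (sum_n (fun n => 1 / INR (S n) ^ 2)) (PI ^ 2 / 6)); [exact B|].
    intros n; rewrite sum_Sn; change plus with Rplus; generalize (Pos (S n)); lra.
  - intros n _; rewrite Cmod_inv_nat; field; apply not_0_INR; lia.
Qed.

Lemma le_of_le_plus_inv (x y A : R) : 0 <= A -> (forall N, x <= y + A / INR (S N)) -> x <= y.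
Proof.
  intros HA H; apply Rnot_lt_le; intros Hlt.
  destruct (archimed_cor1 ((x - y) / (A + 1))) as [N [HN N0]].
  { apply Rdiv_lt_0_compat; lra. }
  specialize (H (pred N)); replace (S (pred N)) with N in H by lia.
  apply lt_INR in N0; simpl in N0.
  apply Rlt_div_r in HN; [|lra].
  assert (0 < / INR N) by (apply Rinv_0_lt_compat, N0).
  unfold Rdiv in H; nra.
Qed.

(** The limit [r -> 1] for a finite sum: every [r ^ (2 * n)] is at least [r ^ (2 * N)], so
    continuity of one monomial at 1 suffices. *)
Lemma sum_le_of_dilated (u : nat -> R) (B : R) (N : nat) : (forall n, 0 <= u n) ->
  (forall r, 0 < r < 1 -> sum_f_R0 (fun n => u n * r ^ (2 * n)) N <= B) -> sum_f_R0 u N <= B.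
Proof.
  intros Hu H; apply Rnot_lt_le; intros Hlt.
  set (g := fun r => sum_f_R0 u N * r ^ (2 * N) - B).
  assert (Cg : continuous g 1).
  { apply (ex_derive_continuous g); unfold g; auto_derive; exact I. }
  assert (g1 : 0 < g 1) by (unfold g; rewrite pow1; lra).
  destruct (Cg _ (locally_ball (g 1) (mkposreal _ g1))) as [d Hd].
  assert (d0 := cond_pos d).
  set (r := 1 - Rmin (d / 2) (/ 2)).
  assert (Hr : 0 < r < 1 /\ Rabs (r - 1) < d).
  { unfold r, Rmin; destruct Rle_dec; split; try lra; unfold Rabs; destruct Rcase_abs; lra. }
  assert (G := Hd r (proj2 Hr)); change (Rabs (g r - g 1) < g 1) in G.
  apply Rabs_def2 in G; destruct G as [_ G].
  assert (L : sum_f_R0 u N * r ^ (2 * N) <= sum_f_R0 (fun n => u n * r ^ (2 * n)) N).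
  { rewrite Rmult_comm, scal_sum; apply sum_Rle; intros n Hn.
    apply Rmult_le_compat_l; [apply Hu|].
    replace (2 * N)%nat with (2 * n + (2 * N - 2 * n))%nat by lia; rewrite pow_add.
    assert (0 <= r ^ (2 * n)) by (apply pow_le; lra).
    assert (r ^ (2 * N - 2 * n) <= 1 ^ (2 * N - 2 * n)) by (apply pow_incr; lra).
    rewrite pow1 in *; nra. }
  specialize (H r (proj1 Hr)); assert (Gr : 0 < g r) by lra; unfold g in Gr; lra.
Qed.

Lemma class_U_partial_sums (f G : C -> C) (a : nat -> C) :
  class_U f -> cps a G -> a 0%nat = 0%C ->
  (forall z, Cmod z < 1 -> z <> 0%C -> Cexp (2 * G z)%C = (f z / z)%C) ->
  forall N, sum_f_R0 (fun n => Cmod (a n) ^ 2) N <= PI ^ 2 / 6.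
Proof.
  intros [[_ [f0 _]] HU] HG a0 He.
  destruct (cps_holo _ _ HG) as (G' & _ & HoG).
  assert (G0 := cps_at_0 _ _ HG); rewrite a0 in G0.
  set (W := fun z => (1 + - (1) * Cexp (- (1) * G z))%C).
  set (W' := fun z => (0 + - (1) * (- (1) * G' z * Cexp (- (1) * G z)))%C).
  assert (HW : holo 1 W W').
  { exact (holo_plus 1 _ _ _ _ (holo_const 1 1%C) (holo_scal 1 (-(1))%C _ _
       (holo_Cexp_comp 1 _ _ (holo_scal 1 (-(1))%C _ _ HoG)))). }
  assert (W0 : W 0%C = 0%C).
  { unfold W; rewrite G0; replace (- (1) * 0)%C with (RtoC 0) by ring; rewrite Cexp_0; ring. }
  assert (Ef : forall z, Cmod z < 1 -> (z * Cexp (2 * G z))%C = f z).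
  { intros z Hz; destruct (Ceq_dec z 0%C) as [->|Nz]; [rewrite f0; ring|].
    rewrite He by assumption; field; exact Nz. }
  assert (Df : forall z, Cmod z < 1 ->
     cderive f z (Cexp (2 * G z) + z * (2 * G' z * Cexp (2 * G z)))%C).
  { assert (Ho := holo_mult _ _ _ _ _ (holo_id 1) (holo_Cexp_comp 1 _ _ (holo_scal 1 2%C _ _ HoG))).
    cbv beta in Ho.
    intros z Hz; destruct (holo_ext 1 _ f _ Ef Ho z Hz)
      as [D _].
    eapply cderive_eq; [exact D|ring]. }
  assert (HU' : forall z, Cmod z < 1 -> z <> 0%C ->
     Cmod ((1 - W z) ^ 2 + 2 * (1 - W z) * (z * W' z) - 1)%C < 1).
  { intros z Hz Nz; destruct (HU z Hz Nz) as [Nf B].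
    rewrite (cderive_unique _ _ _ (Df z Hz)) in B.
    refine (eq_ind _ (fun x => Cmod x < 1) B _ _).
    (* With [E = Cexp (G z)], both expressions are [(1 + 2 z G') / E^2 - 1], since [1 - W = 1 / E]
       and [W' = G' / E]. *)
    assert (E2 : Cexp (2 * G z) = (Cexp (G z) * Cexp (G z))%C) by (rewrite <- Cexp_plus; f_equal; ring).
    assert (NE := Cexp_neq_0 (G z)).
    unfold W, W'; rewrite <- Ef, E2 by exact Hz.
    replace (- (1) * G z)%C with (- G z)%C by ring; rewrite Cexp_opp; field; auto. }
  assert (HM := fun r Hr => Jack_class_U W W' r HW W0 Hr HU').
  (* Schwarz's lemma on a circle around [z], where the bound [M < 1] holds, replaces a maximum
     principle. *)
  assert (HW1 : forall z, Cmod z < 1 -> Cmod (W z) < 1).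
  { intros z Hz; assert (z0 := Cmod_ge_0 z).
    destruct (HM ((1 + Cmod z) / 2) ltac:(lra)) as (M & M1 & HWM).
    assert (S := Schwarz_circle 1 ((1 + Cmod z) / 2) M W W' z HW ltac:(lra) W0 ltac:(lra) HWM).
    assert (M * Cmod z <= 1 * Cmod z) by (apply Rmult_le_compat_r; lra).
    apply Rnot_le_lt; intros N; nra. }
  destruct log_series as (L & HL & EL).
  (* Both sides are continuous logarithms of [1 / (1 - W)] that vanish at 0. *)
  assert (EG : forall z, Cmod z < 1 -> G z = L (W z)).
  { apply Cexp_branch_unique.
    - intros z Hz; exact (cps_ccont _ _ _ HG Hz).
    - intros z Hz; apply (ccont_comp (U := C_UniformSpace) L W).
      + exact (holo_ccont _ _ _ _ HW Hz).
      + exact (cps_ccont _ _ _ HL (HW1 z Hz)).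
    - rewrite G0, W0, (cps_at_0 _ _ HL), inv_nat_0; reflexivity.
    - intros z Hz; rewrite EL by apply HW1, Hz; unfold W.
      replace (- (1) * G z)%C with (- G z)%C by ring; rewrite Cexp_opp.
      assert (NE := Cexp_neq_0 (G z)).
      replace (1 - (1 + - (1) * / Cexp (G z)))%C with (/ Cexp (G z))%C by ring; field; exact NE. }
  intros N; apply sum_le_of_dilated; [intros n; apply pow2_ge_0|].
  intros r Hr; destruct (HM r Hr) as (M & M1 & HWM).
  (* The error of [Littlewood] is [(x / (1 - M))^2] with [x = / INR (S K)]; as [x <= 1], it is at
     most [x / (1 - M)^2], which is linear in [x]. *)
  apply (le_of_le_plus_inv _ _ ((/ (1 - M)) ^ 2)); [apply pow2_ge_0|].
  intros K; assert (P := PI_RGT_0).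
  assert (Li := Littlewood (S K) inv_nat L W W' r M (/ INR (S K)) HL HW W0 HW1 Hr (proj2 M1) HWM).
  assert (Bs := Bessel N a G r HG Hr).
  rewrite (mean_sq_ext r G (fun z => L (W z))) in Bs
    by (intros t; apply EG; rewrite Cmod_circle; lra).
  assert (Kp : 0 < INR (S K)) by (apply lt_0_INR; lia).
  assert (Li' := Rle_trans _ _ _ Bs (Li ltac:(intros [|n] Hn; [lia|apply inv_nat_le; lia]))).
  apply Rmult_le_reg_l in Li'; [|lra].
  eapply Rle_trans; [exact Li'|apply Rplus_le_compat; [apply sum_inv_nat_le|]].
  unfold Rdiv; rewrite Rpow_mult_distr, Rmult_comm; apply Rmult_le_compat_l; [apply pow2_ge_0|].
  assert (/ INR (S K) <= 1).
  { rewrite <- Rinv_1; apply Rinv_le_contravar; [lra|]; change 1 with (INR 1); apply le_INR; lia. }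
  assert (0 < / INR (S K)) by (apply Rinv_0_lt_compat, Kp); set (x := / INR (S K)) in *; clearbody x; simpl; nra.
Qed.

Lemma class_U_log_coeffs (f : C -> C) (gamma : nat -> C) : class_U f -> log_coeffs f gamma ->
  ex_series (fun n => Cmod (gamma (S n)) ^ 2) /\
  Series (fun n => Cmod (gamma (S n)) ^ 2) <= PI ^ 2 / 6.
Proof.
  intros HU Hg; destruct (log_coeffs_cps _ _ Hg) as (G & a & HG & a0 & Ea & He).
  assert (B : forall n, sum_n (fun n => Cmod (gamma (S n)) ^ 2) n <= PI ^ 2 / 6).
  { intros n; assert (S1 := class_U_partial_sums f G a HU HG a0 He (S n)).
    rewrite decomp_sum in S1 by lia; simpl (pred (S n)) in S1.
    rewrite a0, Cmod_0, pow_i, Rplus_0_l in S1 by lia.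
    rewrite sum_n_Reals, (sum_eq _ (fun n => Cmod (a (S n)) ^ 2)); [exact S1|].
    intros i _; rewrite Ea; reflexivity. }
  assert (Ex : ex_series (fun n => Cmod (gamma (S n)) ^ 2)).
  { destruct (ex_finite_lim_seq_incr (sum_n (fun n => Cmod (gamma (S n)) ^ 2)) (PI ^ 2 / 6)) as [l Hl];
      [|exact B|exists l; exact Hl].
    intros n; rewrite sum_Sn; change plus with Rplus.
    generalize (pow2_ge_0 (Cmod (gamma (S (S n))))); lra. }
  split; [exact Ex|].
  exact (is_lim_seq_le _ _ (Series _) (PI ^ 2 / 6) B (Series_correct _ Ex) (is_lim_seq_const _)).
Qed.

(** * The Koebe function, and a function of the class with [|gamma 2| > 1/2] *)

Lemma koebe_class_U (theta : R) : class_U (koebe theta).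
Proof.
  unfold koebe; rewrite Cexp_cis; set (c := cis theta).
  assert (Hc : Cmod c = 1) by apply Cmod_cis.
  assert (Hcz : forall z, Cmod z < 1 -> Cmod (c * z)%C < 1) by (intros z Hz; rewrite Cmod_mult, Hc; lra).
  apply (class_U_quotient (fun z => (1 - c * z) ^ 2)%C (fun z => - (2) * c * (1 - c * z))%C).
  - intros z Hz.
    assert (D : cderive (fun z => 1 - c * z)%C z (- c)%C).
    { eapply cderive_eq; [apply cderive_minus; [apply cderive_const|]|].
      - apply cderive_mult; [apply cderive_const|apply cderive_id].
      - cbv beta; ring. }
    apply (cderive_ext (fun z => (1 - c * z) * (1 - c * z))%C); [intros y; ring|].
    eapply cderive_eq; [apply cderive_mult; exact D|cbv beta; ring].
  - ring.
  - intros z Hz; apply Cpow_nz, Cneq_1_of_Cmod, Hcz, Hz.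
  - intros z Hz Nz.
    replace ((1 - c * z) ^ 2 - z * (- (2) * c * (1 - c * z)) - 1)%C with (- (c * z) ^ 2)%C by ring.
    rewrite Cmod_opp, Cmod_pow; specialize (Hcz z Hz); generalize (Cmod_ge_0 (c * z)%C); simpl; nra.
Qed.

Lemma koebe_log_cps (theta : R) : exists G,
  cps (fun n => inv_nat n * cis theta ^ n)%C G /\
  forall z, Cmod z < 1 -> z <> 0%C -> Cexp (2 * G z)%C = (koebe theta z / z)%C.
Proof.
  destruct log_series as (L & HL & EL).
  exists (fun z => L (cis theta * z)%C); split.
  - apply cps_dilate; [exact HL|rewrite Cmod_cis; lra].
  - intros z Hz Nz; unfold koebe; rewrite Cexp_cis.
    assert (Hcz : Cmod (cis theta * z)%C < 1) by (rewrite Cmod_mult, Cmod_cis; lra).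
    assert (N := Cneq_1_of_Cmod _ Hcz).
    replace (2 * L (cis theta * z))%C with (L (cis theta * z) + L (cis theta * z))%C by ring.
    rewrite Cexp_plus, EL by exact Hcz; field; auto.
Qed.

(** Uniqueness of the branch, then of power series coefficients, identifies an arbitrary admissible
    [gamma] with the explicit sequence of [koebe_log_cps]. *)
Lemma koebe_log_coeffs_Cmod (theta : R) (gamma : nat -> C) (n : nat) :
  log_coeffs (koebe theta) gamma -> Cmod (gamma (S n)) ^ 2 = 1 / INR (S n) ^ 2.
Proof.
  intros Hg; destruct (log_coeffs_cps _ _ Hg) as (G & a & HG & a0 & Ea & He).
  destruct (koebe_log_cps theta) as (K & HK & EK).
  assert (G0 := cps_at_0 _ _ HG); rewrite a0 in G0.
  assert (K0 := cps_at_0 _ _ HK); cbv beta in K0; rewrite inv_nat_0, Cmult_0_l in K0.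
  assert (E : forall z, Cmod z < 1 -> (2 * K z)%C = (2 * G z)%C).
  { apply Cexp_branch_unique.
    - intros z Hz; apply (ccont_mult (U := C_UniformSpace)); [apply ccont_const|exact (cps_ccont _ _ _ HK Hz)].
    - intros z Hz; apply (ccont_mult (U := C_UniformSpace)); [apply ccont_const|exact (cps_ccont _ _ _ HG Hz)].
    - rewrite K0, G0; reflexivity.
    - intros z Hz; destruct (Ceq_dec z 0%C) as [->|Nz]; [rewrite K0, G0; reflexivity|].
      rewrite He, EK by assumption; reflexivity. }
  assert (HG' : cps (fun n => inv_nat n * cis theta ^ n)%C G).
  { intros z Hz; replace (G z) with (K z); [apply HK, Hz|].
    replace (K z) with (/ 2 * (2 * K z))%C by field; rewrite E by exact Hz; field. }
  rewrite <- Ea, (cps_unique _ _ _ HG HG' (S n)), Cmod_mult, Cmod_pow, Cmod_cis, pow1, Cmod_inv_nat.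
  field; apply not_0_INR; lia.
Qed.

(** Expanded, [1 + a z - z^3 / 2] with [a = 3/2]. The map [h - z h'] kills the linear term, so [a]
    is free as long as no zero enters the disk; [3/2] is the largest real choice, with a double zero
    at -1. Since [gamma 2 = a^2 / 4], any [a] above [sqrt 2] gives more than 1/2. *)
Definition cubic (z : C) : C := ((1 + z) ^ 2 * (1 - / 2 * z))%C.

Lemma cubic_class_U : class_U (fun z => z / cubic z)%C.
Proof.
  apply (class_U_quotient cubic (fun z => 3 / 2 - 3 / 2 * (z * z))%C).
  - intros z _.
    apply (cderive_ext (fun z => 1 + (3 / 2 * z + - / 2 * (z * (z * z))))%C).
    { intros y; unfold cubic; field. }
    eapply cderive_eq.
    + apply cderive_plus; [apply cderive_const|apply cderive_plus].
      * apply cderive_mult; [apply cderive_const|apply cderive_id].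
      * apply cderive_mult; [apply cderive_const|].
        apply cderive_mult; [apply cderive_id|apply cderive_mult; apply cderive_id].
    + cbv beta; field.
  - unfold cubic; field.
  - intros z Hz; apply Cmult_neq_0; [apply Cpow_nz|].
    + replace (1 + z)%C with (1 - - z)%C by ring; apply Cneq_1_of_Cmod; rewrite Cmod_opp; exact Hz.
    + apply Cneq_1_of_Cmod; rewrite Cmod_mult, Cmod_inv, Cmod_R by (intros E; apply RtoC_inj in E; lra).
      rewrite Rabs_pos_eq by lra; generalize (Cmod_ge_0 z); lra.
  - intros z Hz _.
    replace (cubic z - z * (3 / 2 - 3 / 2 * (z * z)) - 1)%C with (z ^ 3)%C by (unfold cubic; field).
    rewrite Cmod_pow; assert (z0 := Cmod_ge_0 z).
    assert (Cmod z ^ 2 < 1) by (simpl; nra); simpl in *; nra.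
Qed.

Lemma cubic_log_coeffs : log_coeffs (fun z => z / cubic z)%C
  (fun n => inv_nat n * (- (1)) ^ n + / 2 * (inv_nat n * (/ 2) ^ n))%C.
Proof.
  destruct log_series as (L & HL & EL).
  assert (H1 : Cmod (- (1))%C <= 1) by (rewrite Cmod_opp, Cmod_1; lra).
  assert (H2 : Cmod (/ 2)%C <= 1).
  { rewrite <- RtoC_inv by lra; rewrite Cmod_R, Rabs_pos_eq; lra. }
  apply (log_coeffs_of_cps _ (fun z => L (- (1) * z) + / 2 * L (/ 2 * z))%C).
  - apply cps_plus; [exact (cps_dilate _ _ _ HL H1)|].
    apply cps_scal; exact (cps_dilate _ _ _ HL H2).
  - rewrite inv_nat_0; ring.
  - intros z Hz Nz.
    assert (A1 : Cmod (- (1) * z)%C < 1) by (rewrite Cmod_mult; generalize (Cmod_ge_0 z); nra).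
    assert (A2 : Cmod (/ 2 * z)%C < 1) by (rewrite Cmod_mult; generalize (Cmod_ge_0 z); nra).
    assert (N1 := Cneq_1_of_Cmod _ A1); assert (N2 := Cneq_1_of_Cmod _ A2).
    replace (2 * (L (- (1) * z) + / 2 * L (/ 2 * z)))%C
      with (L (- (1) * z) + L (- (1) * z) + L (/ 2 * z))%C by field.
    rewrite !Cexp_plus, !EL by assumption; unfold cubic.
    replace (1 - - (1) * z)%C with (1 + z)%C in * by ring.
    set (p := (1 + z)%C) in *; set (q := (1 - / 2 * z)%C) in *; field; auto.
Qed.

(** [Series] is total, so each statement about a sum of squares comes with [ex_series]. For the
    Koebe function the existence of coefficients is asserted too, lest the equality for all [gamma]
    be vacuous. *)
Theorem corollary1 :
  (forall (f : C -> C) (gamma : nat -> C),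
     class_U f -> log_coeffs f gamma ->
     ex_series (fun n : nat => Cmod (gamma (S n)) ^ 2) /\
     Series (fun n : nat => Cmod (gamma (S n)) ^ 2)
       <= Series (fun n : nat => 1 / INR (S n) ^ 2)) /\
  is_series (fun n : nat => 1 / INR (S n) ^ 2) (PI ^ 2 / 6) /\
  (forall theta : R,
     class_U (koebe theta) /\
     (exists gamma : nat -> C, log_coeffs (koebe theta) gamma) /\
     (forall gamma : nat -> C, log_coeffs (koebe theta) gamma ->
        ex_series (fun n : nat => Cmod (gamma (S n)) ^ 2) /\
        Series (fun n : nat => Cmod (gamma (S n)) ^ 2)
          = Series (fun n : nat => 1 / INR (S n) ^ 2))) /\
  (exists (f : C -> C) (gamma : nat -> C) (n : nat),
     class_U f /\ log_coeffs f gamma /\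
     (1 <= n)%nat /\ 1 / INR n < Cmod (gamma n)).
Proof.
  split; [|split; [exact Basel|split]].
  - intros f gamma; rewrite (is_series_unique _ _ Basel); apply class_U_log_coeffs.
  - intros theta; split; [apply koebe_class_U|split].
    + destruct (koebe_log_cps theta) as (G & HG & EG); eexists.
      apply (log_coeffs_of_cps _ G _ HG); [|exact EG].
      rewrite inv_nat_0; ring.
    + intros gamma Hg; split.
      * exact (proj1 (class_U_log_coeffs _ _ (koebe_class_U theta) Hg)).
      * apply Series_ext; intros n; exact (koebe_log_coeffs_Cmod _ _ n Hg).
  - exists (fun z => z / cubic z)%C; eexists; exists 2%nat.
    split; [exact cubic_class_U|split; [exact cubic_log_coeffs|split; [lia|]]].
    replace (inv_nat 2 * (- (1)) ^ 2 + / 2 * (inv_nat 2 * (/ 2) ^ 2))%C with (RtoC (9 / 16)).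
    + rewrite Cmod_R, Rabs_pos_eq; simpl; lra.
    + unfold inv_nat; rewrite RtoC_inv, RtoC_div by (simpl; lra); simpl INR.
      rewrite RtoC_plus; field.
Qed.
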